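(* Let $N^n\subset M^{n+1}\subset\mathbb{R}^{n+2}$ be a non-degenerate immersion and let $\xi$ be a nowhere-vanishing vector field along $N$ in the osculating Darboux direction. Let $g=g_\xi$ be the affine metric on $N$, let $\sigma(\xi)$ be the affine normal plane bundle, $\nabla=\nabla(\xi)$ the connection it induces on $N$, $\eta$ any vector field in $\sigma(\xi)$ normalized as in the definition of the affine normal plane bundle, and $h^2$, $C^2$ the corresponding bilinear form and cubic form. The following statements are equivalent: \begin{enumerate} \item The cubic form $C^2$ is apolar with respect to $h^2$, i.e. $\mathrm{tr}_{h^2}C^2(X,\cdot,\cdot)=0$ for every $X$ tangent to $N$. \item The pair $(\nabla,g)$ is equiaffine, i.e. $\nabla(\omega_g)=0$, where $\omega_g$ is the volume form of $g$. \item The vector field $\xi$ is parallel, i.e. $D_X\xi$ is tangent to $N$ for every $X$ tangent to $N$. \end{enumerate}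
   Context: $D$ is the standard flat connection and $[\cdot,\dots,\cdot]$ the determinant in $\mathbb{R}^{n+2}$. $M$ is a smooth hypersurface, $N$ a codimension $1$ immersed submanifold of $M$. For $\eta$ along $N$ transversal to $M$ and $\xi$ along $N$ tangent to $M$ and transversal to $N$, and for $X,Y$ tangent to $N$, write $$D_XY=\nabla_XY+h^1(X,Y)\xi+h^2(X,Y)\eta,$$ $$D_X\xi=-S_1X+\tau_1^1(X)\xi+\tau_1^2(X)\eta,\qquad D_X\eta=-S_2X+\tau_2^1(X)\xi+\tau_2^2(X)\eta,$$ with $\nabla_XY,S_1X,S_2X$ tangent to $N$. $N\subset M$ is non-degenerate if $h^2$ is non-degenerate at each point (independent of choices). Then there is a unique direction along $N$ tangent to $M$ and transversal to $N$, spanned by $\xi$ with $D_X\xi$ tangent to $M$ (i.e. $\tau_1^2=0$) for all $X\in TN$: the osculating Darboux direction. Affine metric: for $\xi$ in this direction and a local frame $\{X_1,\dots,X_n\}$ of $TN$ let $G_\xi(X,Y)=[X_1,\dots,X_n,D_XY,\xi]$ and $g_\xi(X,Y)=G_\xi(X,Y)/|\det(G_\xi(X_i,X_j))|^{1/(n+2)}$. With frames positively oriented for a fixed local orientation of $N$, this non-degenerate metric does not depend on the frame. Affine normal plane bundle: there is a vector field $\eta$ along $N$, transversal to $M$, such that $[X_1,\dots,X_n,\eta,\xi]=1$ for every (positively oriented) $g_\xi$-orthonormal frame of $TN$ and $D_X\eta$ is tangent to $M$ (i.e. $\tau_2^2=0$) for all $X\in TN$; then $h^2=g_\xi$. Such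 $\eta$ is unique up to replacing it by $\eta+\lambda\xi$ with $\lambda$ a function. The affine normal plane bundle $\sigma(\xi)$ is the bundle spanned by $\{\xi,\eta\}$; the induced $\nabla$, $h^2$ do not depend on $\lambda$. Orthonormal means $g(X_i,X_j)=\delta_{ij}$ (or $\pm\delta_{ij}$ if $g$ is indefinite). The cubic form is $C^2(X,Y,Z)=(\nabla_Xh^2)(Y,Z)+\tau_1^2(X)h^1(Y,Z)+\tau_2^2(X)h^2(Y,Z)$, which here equals $(\nabla_Xh^2)(Y,Z)$. *)

(* Defs.v *)
From HB Require Import structures.
From mathcomp Require Import all_boot all_order all_algebra.
From mathcomp Require Import all_classical all_reals all_analysis.

Set Implicit Arguments.
Unset Strict Implicit.
Unset Printing Implicit Defensive.

Import Order.TTheory GRing.Theory Num.Theory.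
Import numFieldNormedType.Exports.

Local Open Scope classical_set_scope.
Local Open Scope ring_scope.

Section Smooth.
Context {R : realType} {m : nat} {V : normedModType R}.

Fixpoint Ck (k : nat) (U : set 'rV[R]_m) (f : 'rV[R]_m -> V) : Prop :=
  match k with
  | 0 => forall x, U x -> {for x, continuous f}
  | k'.+1 => (forall x, U x -> differentiable f x) /\
             forall v, Ck k' U (fun x => 'D_v f x)
  end.

(* Meant for open U. *)
Definition smooth_on (U : set 'rV[R]_m) (f : 'rV[R]_m -> V) : Prop :=
  forall k, Ck k U f.

End Smooth.

(* A smooth manifold of dimension m.  The atlas is indexed by the points:
   [chart p], with domain [chart_dom p] containing p and inverse [par p], is a
   chart around p.  Any atlas can be so presented, choosing at each point one of
   its charts; the smooth structure is unchanged.  [chart p] and [par p] are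
   total functions, only relevant on [chart_dom p] and on its image. *)
Record manifold (R : realType) (m : nat) := Manifold {
  carrier :> topologicalType;
  manifold_hausdorff : hausdorff_space carrier;
  manifold_second_countable : @second_countable carrier;
  chart_dom : carrier -> set carrier;
  chart : carrier -> carrier -> 'rV[R]_m;
  par : carrier -> 'rV[R]_m -> carrier;
  chart_dom_open : forall p, open (chart_dom p);
  chart_dom_self : forall p, chart_dom p p;
  image_open : forall p, open (chart p @` chart_dom p);
  chartK : forall p q, chart_dom p q -> par p (chart p q) = q;
  chart_continuous : forall p q, chart_dom p q -> {for q, continuous (chart p)};
  par_continuous : forall p x, (chart p @` chart_dom p) x ->
    {for x, continuous (par p)};
  transition_smooth : forall p q,
    smooth_on (chart p @` (chart_dom p `&` chart_dom q)) (chart q \o par p)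
}.

Arguments chart_dom {R m} _ p.
Arguments chart {R m} {_} p q.
Arguments par {R m} {_} p x.

Section MapsOnManifolds.
Context {R : realType} {m : nat} {N : manifold R m}.

(* Smoothness in a neighbourhood of p. *)
Definition smooth_at {V : normedModType R} (p : N) (f : N -> V) : Prop :=
  exists2 U, open_nbhs (chart p p) U & smooth_on U (f \o par p).

(* Differential at p of f : N -> R^d, acting on row vectors on the right; its
   row space is the image of the tangent space of N at p. *)
Definition jac {d : nat} (f : N -> 'rV[R]_d) (p : N) : 'M[R]_(m, d) :=
  'J (f \o par p) (chart p p).

Definition immersion_vec {d : nat} (f : N -> 'rV[R]_d) : Prop :=
  forall p, smooth_at p f /\ row_free (jac f p).

Definition immersion {k : nat} {M : manifold R k} (j : N -> M) : Prop :=
  forall p, [/\ {for p, continuous j},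
                smooth_at p (chart (j p) \o j) &
                row_free (jac (chart (j p) \o j) p)].

End MapsOnManifolds.

(* An n-dimensional manifold N immersed in R^(n+2) by f.  The tangent space
   T_pN is identified with its image in R^(n+2), the row space of [jac f p].
   Vector fields along N are maps N -> R^(n+2); they need only be meaningful
   near the point under consideration. *)
Section Codimension2.
Context {R : realType} {n : nat} {N : manifold R n}.
Variable f : N -> 'rV[R]_(n + 2).

Notation field := (N -> 'rV[R]_(n + 2)).

Definition tangent_field (p : N) (X : field) : Prop :=
  smooth_at p X /\ \forall q \near p, (X q <= jac f q)%MS.

Definition frame_mx (E : 'I_n -> field) (p : N) : 'M[R]_(n, n + 2) :=
  \matrix_(i < n) E i p.

Definition local_frame (p : N) (E : 'I_n -> field) : Prop :=
  (forall i, tangent_field p (E i)) /\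
  \forall q \near p, row_free (frame_mx E q).

(* The bracket [X_1, ..., X_n, u, v], where X_i is the i-th row of A. *)
Definition bracket (A : 'M[R]_(n, n + 2)) (u v : 'rV[R]_(n + 2)) : R :=
  \det (col_mx A (col_mx u v) : 'M[R]_(n + 2)).

(* The derivative at p of a function Y on N in the direction X p, where X is
   tangent to N: [X p *m pinvmx (jac f p)] is the tangent vector X p read in
   the chart at p.  For Y a vector field along N, this is D_X Y. *)
Definition dir_deriv {V : normedModType R} (X : field) (Y : N -> V) (p : N)
    : V :=
  'D_(X p *m pinvmx (jac f p)) (Y \o par p) (chart p p).

Section Induced.
Variables xi eta : field.

(* Coordinates of w with respect to a basis of T_pN followed by xi, eta. *)
Definition coords (p : N) (w : 'rV[R]_(n + 2)) : 'rV[R]_(n + (1 + 1)) :=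
  w *m invmx (col_mx (jac f p) (col_mx (xi p) (eta p)) : 'M[R]_(n + 2)).

Definition tan_part (p : N) (w : 'rV[R]_(n + 2)) : 'rV[R]_(n + 2) :=
  lsubmx (coords p w) *m jac f p.
Definition xi_part (p : N) (w : 'rV[R]_(n + 2)) : R :=
  lsubmx (rsubmx (coords p w)) 0 0.
Definition eta_part (p : N) (w : 'rV[R]_(n + 2)) : R :=
  rsubmx (rsubmx (coords p w)) 0 0.

Definition nabla (X Y : field) : field := fun p => tan_part p (dir_deriv X Y p).
Definition h1 (X Y : field) (p : N) : R := xi_part p (dir_deriv X Y p).
Definition h2 (X Y : field) (p : N) : R := eta_part p (dir_deriv X Y p).
Definition tau12 (X : field) (p : N) : R := eta_part p (dir_deriv X xi p).
Definition tau22 (X : field) (p : N) : R := eta_part p (dir_deriv X eta p).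

Definition nabla_form2 (h : field -> field -> N -> R) (X Y Z : field) (p : N)
    : R :=
  dir_deriv X (h Y Z : N -> R^o) p - h (nabla X Y) Z p - h Y (nabla X Z) p.

Definition nabla_formn (omega : ('I_n -> field) -> N -> R) (X : field)
    (Z : 'I_n -> field) (p : N) : R :=
  dir_deriv X (omega Z : N -> R^o) p -
  \sum_(i < n) omega (fun k => if k == i then nabla X (Z i) else Z k) p.

Definition cubic_form (X Y Z : field) (p : N) : R :=
  nabla_form2 h2 X Y Z p + tau12 X p * h1 Y Z p + tau22 X p * h2 Y Z p.

(* tr_{h2} C2(X, ., .) = \sum_(i, j) h^{ij} C2(X, E_i, E_j) = 0 *)
Definition apolar_at (p : N) : Prop :=
  forall X E, tangent_field p X -> local_frame p E ->
    \tr (invmx (\matrix_(i, j) h2 (E i) (E j) p) *m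
         \matrix_(i, j) cubic_form X (E i) (E j) p) = 0.

End Induced.

Definition basis_at (p : N) (A : 'M[R]_(n, n + 2)) : bool :=
  row_free A && (A <= jac f p)%MS.

(* [pos p A] says that the basis A of T_pN is positively oriented. *)
Definition orientation_on (W : set N) (pos : N -> 'M[R]_(n, n + 2) -> bool)
    : Prop :=
  forall p, W p ->
    (forall A B, basis_at p A -> basis_at p B ->
       (pos p A == pos p B) = (0 < \det (B *m pinvmx A))) /\
    (forall E, local_frame p E ->
       \forall q \near p, pos q (frame_mx E q) = pos p (frame_mx E p)).

Section AffineMetric.
Variables (pos : N -> 'M[R]_(n, n + 2) -> bool) (xi : field).

Definition G_in (E : 'I_n -> field) (X Y : field) (p : N) : R :=
  bracket (frame_mx E p) (dir_deriv X Y p) (xi p).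

Definition metric_in (E : 'I_n -> field) (X Y : field) (p : N) : R :=
  G_in E X Y p /
  `|\det (\matrix_(i, j) G_in E (E i) (E j) p)| `^ (n.+2%:R)^-1.

Definition positive_frame (p : N) (E : 'I_n -> field) : Prop :=
  local_frame p E /\ pos p (frame_mx E p).

(* g_xi: its value at p does not depend on the positive frame picked here. *)
Definition affine_metric (X Y : field) (p : N) : R :=
  metric_in (xget (fun=> fun=> 0) [set E | positive_frame p E]) X Y p.

Definition orthonormal_at (p : N) (E : 'I_n -> field) : Prop :=
  forall i k, if i == k then `|affine_metric (E i) (E k) p| = 1
              else affine_metric (E i) (E k) p = 0.

Definition volume_form (Z : 'I_n -> field) (p : N) : R :=
  (if pos p (frame_mx Z p) then 1 else -1) *
  Num.sqrt `|\det (\matrix_(i, k) affine_metric (Z i) (Z k) p)|.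

Definition equiaffine_at (eta : field) (p : N) : Prop :=
  forall X Z, tangent_field p X -> (forall i, tangent_field p (Z i)) ->
    nabla_formn xi eta volume_form X Z p = 0.

End AffineMetric.

Definition parallel_at (xi : field) (p : N) : Prop :=
  forall X, tangent_field p X -> (dir_deriv X xi p <= jac f p)%MS.

End Codimension2.

(* N immersed by j in the hypersurface M, itself immersed in R^(n+2) by F. *)
Section Hypersurface.
Context {R : realType} {n : nat} {M : manifold R n.+1} {N : manifold R n}.
Variables (F : M -> 'rV[R]_(n + 2)) (j : N -> M).

Notation field := (N -> 'rV[R]_(n + 2)).
Local Notation f := (F \o j).

Definition tangent_M (p : N) (w : 'rV[R]_(n + 2)) : bool :=
  (w <= jac F (j p))%MS.

Definition adapted_at (p : N) (xi eta : field) : Prop :=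
  [/\ tangent_M p (xi p), ~~ (xi p <= jac f p)%MS & ~~ tangent_M p (eta p)].

(* The quantification over (xi, eta) is harmless, as the condition does not
   depend on this choice. *)
Definition nondegenerate_in : Prop :=
  forall p xi eta, adapted_at p xi eta ->
  forall X, tangent_field f p X ->
    (forall Y, tangent_field f p Y -> h2 f xi eta X Y p = 0) -> X p = 0.

(* In particular, xi vanishes nowhere. *)
Definition osculating_darboux (xi : field) : Prop :=
  forall p, [/\ smooth_at p xi, tangent_M p (xi p), ~~ (xi p <= jac f p)%MS &
    forall X, tangent_field f p X -> tangent_M p (dir_deriv f X xi p)].

(* eta spans, together with xi, the affine normal plane bundle over W. *)
Definition affine_normal (xi : field) (W : set N)
    (pos : N -> 'M[R]_(n, n + 2) -> bool) (eta : field) : Prop :=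
  forall p, W p ->
  [/\ smooth_at p eta, ~~ tangent_M p (eta p),
      (forall E, positive_frame f pos p E -> orthonormal_at f pos xi p E ->
         bracket (frame_mx E p) (eta p) (xi p) = 1) &
      forall X, tangent_field f p X -> tangent_M p (dir_deriv f X eta p)].

End Hypersurface.

(* Main.v *)
(* Let tau X denote the xi-component of D_X xi; since D_X xi is tangent to M, xi is
   parallel iff tau = 0.  Both other conditions are shown to say the same.

   The affine metric is a multiple c of h^2.  Comparing with a positive
   orthonormal frame, which exists by Sylvester's law, the normalization of eta
   gives |c| ^ (n + 2) = |c| ^ n, hence c = 1: g = h^2, and the volume form of g is
   omega Z = [Z_1, ..., Z_n, eta, xi], on all tangent fields Z.

   Differentiating this determinant row by row, and using that D_X eta has no
   eta-component, gives (nabla_X omega) Z = tau X * omega Z.  For a frame E with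
   H = (h^2 (E_i, E_j)) and nabla_X E_i = \sum_k G_ik E_k, one has
   (\det H)^2 = (omega E)^4, so \tr (H^-1 D_X H) = 2 (\tr G + tau X), while the matrix
   of C^2 (X, ., .) is D_X H - G H - H G^T; hence \tr (H^-1 C^2) = 2 tau X.

   That h^2 depends only on the values of the fields follows by differentiating
   [E_1, ..., E_n, Y, xi] = 0, and its symmetry is Schwarz's theorem. *)

Require Import Defs.
From HB Require Import structures.
From mathcomp Require Import all_boot all_order all_algebra.
From mathcomp Require Import all_classical all_reals all_analysis.
From mathcomp Require Import perm ring.

Set Implicit Arguments.
Unset Strict Implicit.
Unset Printing Implicit Defensive.

Import Order.TTheory GRing.Theory Num.Theory.
Import numFieldNormedType.Exports.

Local Open Scope classical_set_scope.
Local Open Scope ring_scope.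

(** * Determinants and symmetric matrices *)

(** [jac f q], [coords] and [dir_deriv] at q are written in the chart at q, and the choice of charts
    may jump with q, so these expressions cannot be differentiated in q as they stand. Whatever is
    differentiated at p is first rewritten near p in the single chart at p, as a bracket or, by
    Cramer's rule, as a quotient of brackets.

    The identities for the volume form and for the determinant of h^2 are needed on a neighbourhood
    of p, since they are differentiated there, and the first also for fields such as nabla_X Z_i,
    which are only shown to be differentiable.

    The exponents n + 2 and n come from two computations. Let s be the determinant of h^2 and d the
    bracket with eta and xi, both in a coordinate basis. The root in the definition of g gives
    |c|^(n+2) |s| = d^2; a g-orthonormal frame of bracket 1 gives |c|^n |s| = d^2. Comparing
    orientations makes c positive, which excludes c = -1. The resulting |s| = d^2 is also the source
    of (\det H)^2 = (omega E)^4. *)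

Section LinearAlgebra.
Context {F : fieldType}.

Definition set_row m n (i : 'I_m) (w : 'rV[F]_n) (A : 'M[F]_(m, n)) :=
  \matrix_(k, l) if k == i then w 0 l else A k l.

Lemma row_set_row m n i k (w : 'rV[F]_n) (A : 'M[F]_(m, n)) :
  row k (set_row i w A) = if k == i then w else row k A.
Proof. by apply/rowP => l; rewrite !mxE; case: ifP => // _; rewrite mxE. Qed.

Lemma set_row_mul m n i (c : 'rV[F]_m) (A : 'M[F]_(m, n)) :
  set_row i (c *m A) A = set_row i c 1%:M *m A.
Proof.
apply/row_matrixP => k; rewrite row_set_row row_mul row_set_row.
by case: ifP => // _; rewrite row1 -rowE.
Qed.

Lemma det_set_row1 m i (c : 'rV[F]_m) : \det (set_row i c 1%:M) = c 0 i.
Proof.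
rewrite (expand_det_col _ i) (bigD1 i)//= big1 ?addr0 => [|k ki].
  rewrite !mxE eqxx /cofactor addnn -signr_odd odd_double expr0 mul1r.
  rewrite (_ : row' _ _ = 1%:M) ?det1 ?mulr1//.
  apply/matrixP => k l; rewrite !mxE eq_sym (negbTE (neq_lift _ _)).
  by rewrite (inj_eq (@lift_inj _ _)).
by rewrite !mxE (negbTE ki) mul0r.
Qed.

(** Cramer's rule; it serves both the brackets and Jacobi's formula in [trace_cubic_form]. *)
Lemma det_set_row m i (c : 'rV[F]_m) (A : 'M[F]_m) :
  \det (set_row i (c *m A) A) = c 0 i * \det A.
Proof. by rewrite set_row_mul det_mulmx det_set_row1. Qed.

Lemma col_mx_set_row m1 m2 n i (w : 'rV[F]_n) (A : 'M[F]_(m1, n))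
    (B : 'M[F]_(m2, n)) :
  col_mx (set_row i w A) B = set_row (lshift m2 i) w (col_mx A B).
Proof.
apply/matrixP => k l; rewrite mxE [RHS]mxE mxE; case: splitP => a ka.
  have -> : k = lshift m2 a by apply: val_inj.
  by rewrite (inj_eq (@lshift_inj _ _)) mxE.
have -> : k = rshift m1 a by apply: val_inj.
by rewrite eq_rlshift.
Qed.

Lemma col_mx_set_row_down m1 m2 n i (w : 'rV[F]_n) (A : 'M[F]_(m1, n))
    (B : 'M[F]_(m2, n)) :
  col_mx A (set_row i w B) = set_row (rshift m1 i) w (col_mx A B).
Proof.
apply/matrixP => k l; rewrite mxE [RHS]mxE mxE; case: splitP => a ka.
  have -> : k = lshift m2 a by apply: val_inj.
  by rewrite eq_lrshift.
have -> : k = rshift m1 a by apply: val_inj.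
by rewrite (inj_eq (@rshift_inj _ _)) mxE.
Qed.

Lemma set_row_rV n (w u : 'rV[F]_n) : set_row 0 w u = w.
Proof. by apply/rowP => l; rewrite mxE eqxx. Qed.

Lemma unit_factor_sub m n (T : 'M[F]_m) (A B : 'M[F]_(m, n)) :
  T \in unitmx -> A = T *m B -> (B <= A)%MS.
Proof. by move=> uT ->; rewrite -{1}(mulKmx uT B) submxMl. Qed.

(** [w *m pinvmx A] holds the coordinates of w in the basis A, so this is a change of basis; it is
    applied to the Jacobians of f in two charts. *)
Lemma pinvmx_factor m n p (T : 'M[F]_m) (A B : 'M[F]_(m, n)) (w : 'M[F]_(p, n)) :
  row_free A -> row_free B -> A = T *m B -> (w <= A)%MS ->
  w *m pinvmx A *m T = w *m pinvmx B.
Proof.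
move=> fA fB AE /submxP[a ->]; rewrite (mulmxKp fA).
by rewrite AE mulmxA (mulmxKp fB).
Qed.

Lemma row_free_mul m n (P : 'M[F]_m) (B : 'M[F]_(m, n)) :
  row_free B -> row_free (P *m B) = (P \in unitmx).
Proof. by move=> fB; rewrite -row_free_unit /row_free mxrankMfree. Qed.

Lemma det_add_row m (A : 'M[F]_m) i (u w : 'rV[F]_m) (b : F) :
  \det (set_row i (u + b *: w) A) = \det (set_row i u A) + b * \det (set_row i w A).
Proof.
rewrite -[\det (set_row i u A)]mul1r.
apply: (@determinant_multilinear _ _ _ _ _ i).
- by rewrite !row_set_row eqxx scale1r.
- apply/matrixP => k l; rewrite !mxE eq_sym.
  by rewrite (negbTE (neq_lift _ _)).
- apply/matrixP => k l; rewrite !mxE eq_sym.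
  by rewrite (negbTE (neq_lift _ _)).
Qed.

End LinearAlgebra.

(** * Diagonalization of symmetric matrices by congruence *)

Section Sylvester.

(* Completing a non-isotropic vector to a basis, block elimination
   splits off one diagonal entry. *)
Lemma symmetric_congruent_diag (F : fieldType) n (S : 'M[F]_n) :
  2%:R != 0 :> F -> S^T = S ->
  exists2 P, P \in unitmx & is_diag_mx (P *m S *m P^T).
Proof.
move=> char2; elim: n S => [|n IH] S symS.
  by exists 1%:M; rewrite ?unitmx1//; apply/is_diag_mxP => -[].
have [->|S0] := eqVneq S 0.
  by exists 1%:M; rewrite ?unitmx1// mulmx0 mul0mx; apply/is_diag_mxP => i j; rewrite mxE.
(* Polarization: if every vector were isotropic, then 2 * S i j = 0 for all i and j. *)
have [v vS] : exists v : 'rV_n.+1, (v *m S *m v^T) 0 0 != 0.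
  apply: contra_neqP S0 => /forallNP vS0.
  have q (v : 'rV_n.+1) : (v *m S *m v^T) 0 0 = 0 by apply/eqP; have /negP := vS0 v; rewrite negbK.
  have e i j : ((delta_mx 0 i : 'rV_n.+1) *m S *m (delta_mx 0 j : 'rV_n.+1)^T) 0 0 = S i j.
    by rewrite -rowE trmx_delta -colE !mxE.
  apply/matrixP => i j; rewrite mxE.
  have := q (delta_mx 0 i + delta_mx 0 j).
  rewrite linearD/= !mulmxDl !mulmxDr mxE [X in X + _]mxE [X in _ + X]mxE !q.
  rewrite add0r addr0 !e -{2}symS mxE => /eqP; rewrite -mulr2n -mulr_natr mulf_eq0.
  by rewrite (negPf char2) orbF => /eqP.
set Q := row_ebase v.
(* The first row of the invertible matrix [row_ebase v] spans the line of v. *)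
have [c vc] : exists c, v = c *: row 0 Q.
  exists (col_ebase v 0 0 * (\rank v != 0)%:R).
  rewrite -{1}(mulmx_ebase v) -mulmxA.
  rewrite {1}[col_ebase v]mx11_scalar mul_scalar_mx -scalerA; congr (_ *: _).
  apply/rowP => k; rewrite !mxE (bigD1 0)//= !mxE/= big1 ?addr0; last first.
    move=> i /negPf i0; rewrite !mxE/=.
    by rewrite [0%N == _]eq_sym (i0 : (val i == 0%N) = false) mul0r.
  by rewrite lt0n.
have {vS} vS : (row 0 Q *m S *m (row 0 Q)^T) 0 0 != 0.
  move: vS; rewrite [in X in X -> _]vc linearZ/= -!scalemxAl -scalemxAr.
  by rewrite scalerA mxE mulf_eq0 => /norP[].
pose T : 'M[F]_(1 + n) := Q *m S *m Q^T.
have symT : T^T = T by rewrite /T !trmx_mul trmxK symS mulmxA.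
have T00 : T 0 0 != 0.
  move: vS; congr (_ != _); rewrite tr_row -row_mul [LHS]mxE [RHS]mxE.
  by apply: eq_bigr => k _; rewrite [row _ _ _ _]mxE [col _ _ _ _]mxE.
pose a := T 0 0; pose b := ursubmx T; pose d := drsubmx T.
have TE : T = block_mx a%:M b b^T d.
  rewrite -[LHS]submxK [ulsubmx T]mx11_scalar; congr block_mx.
    rewrite /ulsubmx [lsubmx _ _ _]mxE [usubmx _ _ _]mxE; congr (_%:M).
    by rewrite /a; congr (fun_of_matrix T _ _); apply: val_inj.
  by rewrite /b trmx_ursub symT.
pose L : 'M[F]_(1 + n) := block_mx 1%:M 0 (- a^-1 *: b^T) 1%:M.
have LS : L *m T *m L^T = block_mx a%:M 0 0 (d - a^-1 *: (b^T *m b)).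
  rewrite TE /L tr_block_mx !mulmx_block !trmx1 !trmx0.
  rewrite linearZ/= trmxK !mul1mx !mul0mx !mulmx1 !mulmx0 !addr0.
  rewrite mul_scalar_mx scalerA mulrN mulfV// scaleN1r addNr.
  rewrite mul_mx_scalar scalerA mulrN mulfV// scaleN1r addNr mul0mx add0r.
  by rewrite -!scalemxAl scaleNr [_ + d]addrC.
have symd : (d - a^-1 *: (b^T *m b))^T = d - a^-1 *: (b^T *m b).
  by rewrite linearB linearZ/= trmx_mul trmxK /d trmx_drsub symT.
have [P unitP diagP] := IH _ symd.
pose P' : 'M[F]_(1 + n) := block_mx 1%:M 0 0 P.
exists (P' *m L *m Q).
  have dP' : \det P' = \det P.
    by apply: (etrans (det_ublock _ _ _)); rewrite det1 mul1r.
  have dL : \det L = 1 by apply: (etrans (det_lblock _ _ _)); rewrite !det1 mulr1.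
  by rewrite !unitmx_mul row_ebase_unit andbT !unitmxE dL dP' unitr1 andbT -unitmxE.
have -> : P' *m L *m Q *m S *m (P' *m L *m Q)^T = P' *m (L *m T *m L^T) *m P'^T.
  by rewrite /T !trmx_mul !mulmxA.
rewrite LS /P' tr_block_mx !trmx0 trmx1 !mulmx_block.
rewrite !mul1mx !mul0mx !mulmx1 !mulmx0 !addr0 !add0r mul0mx.
rewrite (@is_diag_block_mx F 1 n 1 n _ _ _ _ erefl).
rewrite diagP !eqxx !andbT/=.
by apply/is_diag_mxP => i j; rewrite !ord1.
Qed.

(** Row i of the diagonalizing matrix is divided by the square root of |t_i|, where the diagonal
    entry t_i is nonzero because S is invertible. *)
Lemma symmetric_congruent_sign (R : rcfType) n (S : 'M[R]_n) :
  S^T = S -> S \in unitmx ->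
  exists2 P, P \in unitmx & forall i j,
    if i == j then `|(P *m S *m P^T) i j| = 1 else (P *m S *m P^T) i j = 0.
Proof.
move=> symS uS; have two : 2%:R != 0 :> R by rewrite pnatr_eq0.
have [P uP /is_diag_mxP dP] := symmetric_congruent_diag two symS.
set T := P *m S *m P^T in dP.
have uT : T \in unitmx by rewrite !unitmx_mul uP uS unitmx_tr uP.
have dT : is_diag_mx T by apply/is_diag_mxP.
have /diag_mxP[t tE] := dT.
have T0 i : t 0 i != 0.
  move: uT; rewrite tE unitmxE det_diag unitfE prodf_seq_neq0 => /allP/(_ i).
  by rewrite mem_index_enum; apply.
pose D := diag_mx (\row_i (Num.sqrt `|t 0 i|)^-1).
exists (D *m P).
  rewrite unitmx_mul uP andbT unitmxE det_diag unitfE prodf_seq_neq0.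
  apply/allP => i _ /=; rewrite mxE invr_neq0// sqrtr_eq0 -ltNge normr_gt0//.
move=> i j.
have -> : D *m P *m S *m (D *m P)^T = D *m T *m D by rewrite trmx_mul tr_diag_mx !mulmxA.
rewrite tE !mulmx_diag !mxE; case: eqVneq => [->|_]; last by rewrite mulr0n.
rewrite mulr1n mulrAC -invfM -expr2 sqr_sqrtr// mulrC normrM normfV normr_id divff//.
by rewrite normr_eq0.
Qed.

End Sylvester.

(** * Cramer's rule and multilinearity for the bracket *)

Section Bracket.
Context {R : realType} {n : nat}.
Implicit Types (A : 'M[R]_(n, n + 2)) (u v w t : 'rV[R]_(n + 2)).

Lemma bracket_uE A u v w :
  col_mx A (col_mx w v) = set_row (rshift n (lshift 1 0)) w (col_mx A (col_mx u v)).
Proof. by rewrite -col_mx_set_row_down -col_mx_set_row set_row_rV. Qed.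

Lemma bracket_vE A u v w :
  col_mx A (col_mx u w) = set_row (rshift n (rshift 1 0)) w (col_mx A (col_mx u v)).
Proof. by rewrite -2!col_mx_set_row_down set_row_rV. Qed.

(** Cramer's rule in the basis formed by the rows of A, u and v. All tangential, xi- and
    eta-components are extracted from brackets this way. *)
Lemma bracket_lin A u v w (a : 'rV[R]_n) (b c : R) :
  w = a *m A + b *: u + c *: v ->
  [/\ bracket A w v = b * bracket A u v, bracket A u w = c * bracket A u v &
      forall i, bracket (set_row i w A) u v = a 0 i * bracket A u v].
Proof.
move=> wE.
pose e : 'rV_(n + (1 + 1)) := row_mx a (row_mx b%:M c%:M).
have {}wE : w = e *m col_mx A (col_mx u v).
  by rewrite wE !mul_row_col !mul_scalar_mx addrA.
rewrite /bracket; split=> [||i].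
- rewrite (bracket_uE A u v w) {1}wE det_set_row /e row_mxEr.
  by have -> : row_mx b%:M c%:M 0 (lshift 1 0) = b by rewrite row_mxEl mxE eqxx mulr1n.
- rewrite (bracket_vE A u v w) {1}wE det_set_row /e row_mxEr.
  by have -> : row_mx b%:M c%:M 0 (rshift 1 0) = c by rewrite row_mxEr mxE eqxx mulr1n.
- by rewrite col_mx_set_row {1}wE det_set_row /e row_mxEl.
Qed.

Lemma bracket_uZD A u w v (b : R) :
  bracket A (u + b *: w) v = bracket A u v + b * bracket A w v.
Proof.
by rewrite /bracket (bracket_uE A 0 v (_ + _)) det_add_row -!bracket_uE.
Qed.

Lemma bracket_vZD A u w v (b : R) :
  bracket A u (v + b *: w) = bracket A u v + b * bracket A u w.
Proof.
by rewrite /bracket (bracket_vE A u 0 (_ + _)) det_add_row -!bracket_vE.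
Qed.

Lemma bracket_rowZD A i t w u v (b : R) :
  bracket (set_row i (t + b *: w) A) u v =
  bracket (set_row i t A) u v + b * bracket (set_row i w A) u v.
Proof. by rewrite /bracket !col_mx_set_row det_add_row. Qed.

Lemma bracket_mul A (P : 'M[R]_n) u v :
  bracket (P *m A) u v = \det P * bracket A u v.
Proof.
rewrite /bracket.
have -> : col_mx (P *m A) (col_mx u v) =
    block_mx P 0 0 (1%:M : 'M[R]_2) *m col_mx A (col_mx u v).
  by rewrite mul_block_col !mul0mx addr0 add0r mul1mx.
by rewrite det_mulmx det_ublock det1 mulr1.
Qed.

Lemma bracket_sub_u A w v : (w <= A)%MS -> bracket A w v = 0.
Proof.
case/submxP => a wa; have [|-> _ _] := @bracket_lin A 0 v w a 0 0.
  by rewrite wa !scale0r !addr0.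
by rewrite mul0r.
Qed.

Lemma bracket_sub_v A w u : (w <= A)%MS -> bracket A u w = 0.
Proof.
case/submxP => a wa; have [|_ -> _] := @bracket_lin A u 0 w a 0 0.
  by rewrite wa !scale0r !addr0.
by rewrite mul0r.
Qed.

(** A transposition of two rows. It moves the derivative of a coordinate vector into the slot where
    the bracket reads off an eta-component, as [h2E] requires. *)
Lemma bracket_swap A i u v w :
  bracket (set_row i u A) w v = - bracket (set_row i w A) u v.
Proof.
rewrite /bracket.
set B := col_mx (set_row i u A) _; set C := col_mx (set_row i w A) _.
pose i0 : 'I_(n + (1 + 1)) := lshift _ i.
pose j0 : 'I_(n + (1 + 1)) := rshift n (lshift 1 0).
have -> : B = tperm_mx i0 j0 *m C.
  rewrite -xrowE /B /C !col_mx_set_row.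
  rewrite (bracket_uE A 0 v w) (bracket_uE A 0 v u).
  apply/matrixP => k l; rewrite [RHS]mxE !mxE.
  case: tpermP => [->|->|/eqP/negPf -> /eqP/negPf ->//].
    by rewrite eqxx [j0 == lshift _ _]eq_rlshift eqxx.
  by rewrite [j0 == lshift _ _]eq_rlshift !eqxx.
by rewrite det_mulmx det_perm odd_tperm eq_lrshift expr1 mulN1r.
Qed.

End Bracket.

(** * Differential calculus *)

Section DerivativeRules.
Context {R : realType} {V : normedModType R}.
Implicit Types (x v : V).

(** Bundling differentiability with the value lets the rules below chain without side conditions.
    Full differentiability, not just derivability along v, is what chart changes require. *)
Definition has_deriv {W : normedModType R} (f : V -> W) x v (d : W) :=
  differentiable f x /\ 'D_v f x = d.

Lemma has_deriv_cst {W : normedModType R} (c : W) x v :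
  has_deriv (fun=> c) x v 0.
Proof. by split; [exact: differentiable_cst | exact: derive_cst]. Qed.

Lemma has_derivD {W : normedModType R} (f g : V -> W) x v df dg :
  has_deriv f x v df -> has_deriv g x v dg ->
  has_deriv (fun y => f y + g y) x v (df + dg).
Proof.
move=> [f' <-] [g' <-]; split; first exact: differentiableD.
by rewrite [LHS]deriveD//; exact: diff_derivable.
Qed.

Lemma has_derivM (f g : V -> R) x v df dg :
  has_deriv (f : V -> R^o) x v df -> has_deriv (g : V -> R^o) x v dg ->
  has_deriv ((fun y => f y * g y) : V -> R^o) x v (df * g x + f x * dg).
Proof.
move=> [f' <-] [g' <-]; split; first exact: differentiableM.
rewrite [LHS]deriveM; [|exact: diff_derivable..].
by rewrite addrC; congr (_ + _); exact: mulrC.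
Qed.

Lemma has_deriv_sum {W : normedModType R} (I : Type) (r : seq I)
    (f : I -> V -> W) x v df :
  (forall i, has_deriv (f i) x v (df i)) ->
  has_deriv (fun y => \sum_(i <- r) f i y) x v (\sum_(i <- r) df i).
Proof.
move=> hf; elim: r => [|i r IH].
  by under eq_fun do rewrite big_nil; rewrite big_nil; exact: has_deriv_cst.
by under eq_fun do rewrite big_cons; rewrite big_cons; exact: has_derivD.
Qed.

Lemma has_deriv_prod n (f : 'I_n -> V -> R) x v df :
  (forall i, has_deriv (f i : V -> R^o) x v (df i)) ->
  has_deriv ((fun y => \prod_i f i y) : V -> R^o) x v
    (\sum_i \prod_k (if k == i then df i else f k x)).
Proof.
elim: n f df => [|n IH] f df hf.
  by under eq_fun do rewrite big_ord0; rewrite big_ord0; exact: has_deriv_cst.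
under eq_fun do rewrite big_ord_recl.
have := has_derivM (hf ord0) (IH (fun i => f (lift ord0 i)) _ (fun i => hf _)).
congr has_deriv; rewrite big_ord_recl big_ord_recl eqxx; congr (_ + _).
by rewrite mulr_sumr; apply: eq_bigr => i _; rewrite big_ord_recl.
Qed.

(** The Leibniz expansion is differentiated term by term and regrouped by the row of the
    differentiated factor; hence the initial exchange of sums. *)
Lemma has_deriv_det n (A : V -> 'M[R]_n) x v (dA : 'M[R]_n) :
  (forall i k, has_deriv ((fun y => A y i k) : V -> R^o) x v (dA i k)) ->
  has_deriv ((fun y => \det (A y)) : V -> R^o) x v
    (\sum_i \det (set_row i (row i dA) (A x))).
Proof.
move=> hA; rewrite /determinant exchange_big/=.
apply: has_deriv_sum => s.
have hs : has_deriv (fun=> (-1) ^+ s : R^o) x v 0 by exact: has_deriv_cst.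
have := has_derivM hs (has_deriv_prod (fun i => hA i (s i))).
congr has_deriv; rewrite mul0r add0r mulr_sumr; apply: eq_bigr => i _.
congr (_ * _); apply: eq_bigr => k _; rewrite !mxE.
by case: eqVneq => // ->.
Qed.

Lemma has_deriv_entry p q (Y : V -> 'M[R]_(p, q)) x v i k : differentiable Y x ->
  has_deriv ((fun y => Y y i k) : V -> R^o) x v ('D_v Y x i k).
Proof.
move=> dY; split.
  apply: (@differentiable_comp _ _ _ _ Y (fun M : 'M[R]_(p, q) => M i k : R^o)) => //.
  exact: differentiable_coord.
by rewrite derive_mx ?mxE//; exact: diff_derivable.
Qed.

Lemma differentiable_rV q (Y : V -> 'rV[R]_q) x :
  (forall k, differentiable ((fun y => Y y 0 k) : V -> R^o) x) -> differentiable Y x.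
Proof.
move=> dY.
have -> : Y = \sum_k (fun y => Y y 0 k *: (delta_mx 0 k : 'rV[R]_q)).
  by apply/funext => y; rewrite fct_sumE -row_sum_delta.
by apply: differentiable_sum => k; exact: differentiableZl.
Qed.

Lemma has_deriv_bracket n (E : 'I_n -> V -> 'rV[R]_(n + 2))
    (Y Z : V -> 'rV[R]_(n + 2)) x v dE dY dZ :
  (forall i, has_deriv (E i) x v (dE i)) ->
  has_deriv Y x v dY -> has_deriv Z x v dZ ->
  let A y := \matrix_i E i y in
  has_deriv ((fun y => bracket (A y) (Y y) (Z y)) : V -> R^o) x v
    (\sum_i bracket (set_row i (dE i) (A x)) (Y x) (Z x) +
     bracket (A x) dY (Z x) + bracket (A x) (Y x) dZ).
Proof.
move=> hE hY hZ A.
pose dM : 'M[R]_(n + (1 + 1), n + 2) := col_mx (\matrix_i dE i) (col_mx dY dZ).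
have eu (U W : 'rV[R]_(n + 2)) b k : col_mx U W (lshift 1 b) k = U 0 k.
  by rewrite (@col_mxEu _ 1 1) ord1.
have ed (U W : 'rV[R]_(n + 2)) b k : col_mx U W (rshift 1 b) k = W 0 k.
  by rewrite (@col_mxEd _ 1 1) ord1.
have hM i k : has_deriv
    ((fun y => (col_mx (A y) (col_mx (Y y) (Z y)) : 'M[R]_(n + 2)) i k)
      : V -> R^o) x v (dM i k).
  rewrite -[i : 'I_(n + (1 + 1))]splitK /dM.
  case: (fintype.split _) => a /=.
    under eq_fun do rewrite col_mxEu mxE.
    by rewrite col_mxEu mxE; have [h <-] := hE a; exact: has_deriv_entry.
  under eq_fun do rewrite col_mxEd.
  rewrite col_mxEd; have <- := @splitK 1 1 a; case: (fintype.split _) => b /=.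
    under eq_fun do rewrite eu.
    by rewrite eu; have [h <-] := hY; exact: has_deriv_entry.
  under eq_fun do rewrite ed.
  by rewrite ed; have [h <-] := hZ; exact: has_deriv_entry.
have := has_deriv_det hM; congr has_deriv.
rewrite /bracket (@big_split_ord _ _ _ n (1 + 1)) -addrA; congr (_ + _).
  apply: eq_bigr => i _; rewrite col_mx_set_row; congr (\det (set_row _ _ _)).
  by apply/rowP => k; rewrite /dM mxE col_mxEu mxE.
rewrite (@big_split_ord _ _ _ 1 1) !big_ord1; congr (_ + _).
  rewrite (bracket_uE (A x) (Y x) (Z x) dY); congr (\det (set_row _ _ _)).
  by apply/rowP => k; rewrite /dM mxE col_mxEd eu.
rewrite (bracket_vE (A x) (Y x) (Z x) dZ); congr (\det (set_row _ _ _)).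
by apply/rowP => k; rewrite /dM mxE col_mxEd ed.
Qed.

End DerivativeRules.

Section DifferentiableNear.
Context {R : realType} {V W : normedModType R}.

(** The first-order expansion of f at x is also one of g, so by uniqueness its linear part is the
    differential of g. *)
Lemma near_eq_differentiable (f g : V -> W) x :
  (\forall y \near x, f y = g y) -> differentiable f x -> differentiable g x.
Proof.
move=> fg /diff_locallyP[dfc fE].
have gE : g \o shift x = cst (g x) + 'd f x +o_ 0 id.
  apply/eqaddoP => e e0; have /eqaddoP/(_ e e0) := fE.
  have : \forall k \near (0 : V), f (k + x) = g (k + x).
    by move: fg; rewrite (near_shift 0 x)/=; apply: filterS => k; rewrite subr0.
  apply: filterS2 => k fgk; rewrite !fctE/= fgk.
  by rewrite (nbhs_singleton fg).
have dE := diff_unique dfc gE.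
by apply/diff_locallyP; rewrite dE; split.
Qed.

Lemma near_eq_has_deriv (f g : V -> W) x v d :
  (\forall y \near x, f y = g y) -> has_deriv f x v d -> has_deriv g x v d.
Proof.
move=> fg [df <-]; split; first exact: near_eq_differentiable df.
by apply: near_eq_derive; apply: filterS fg => y ->.
Qed.

Lemma has_deriv_comp (U : normedModType R) (c : U -> V) (g : V -> W) x v :
  differentiable c x -> differentiable g (c x) ->
  has_deriv (g \o c) x v ('D_('D_v c x) g (c x)).
Proof.
move=> dc dg; have dgc := differentiable_comp dc dg; split => //.
by rewrite (deriveE v dgc) (deriveE v dc) (deriveE _ dg) (diff_comp dc dg).
Qed.

End DifferentiableNear.

(** * Symmetry of second derivatives *)

Section Schwarz.
Context {R : realType} {V : normedModType R}.

Lemma has_deriv_line (f : V -> R^o) (u a : V) (s : R) :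
  differentiable f (s *: u + a) ->
  is_derive s (1 : R) ((fun t : R => f (t *: u + a)) : R -> R^o)
    ('D_u f (s *: u + a)).
Proof.
move=> df; have df' := @diff_derivable _ _ _ _ _ u df.
have E : (fun h : R => h^-1 *: ((fun t : R => f (t *: u + a)) (h *: 1 + s) -
      (fun t : R => f (t *: u + a)) s)) =
    (fun h : R => h^-1 *: (f (h *: u + (s *: u + a)) - f (s *: u + a))).
  by apply/funext => h; rewrite scalerDl -addrA [h *: 1 in LHS]mulr1.
by split; rewrite /derivable /derive E.
Qed.

(** This expression is symmetric in u and v, while its leading term can be computed along either
    vector first. *)
Definition second_difference (f : V -> R^o) x u v (h : R) :=
  f (x + h *: u + h *: v) - f (x + h *: u) - f (x + h *: v) + f x.

(* Mean value theorem along u for s |-> f (x + s u + h v) - f (x + s u). *)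
Lemma second_difference_near (f : V -> R^o) x u v (e : R) : 0 < e ->
  (\forall y \near x, differentiable f y) -> differentiable ('D_u f) x ->
  \forall h \near (0 : R)^'+,
    `|second_difference f x u v h - h ^+ 2 * 'D_v ('D_u f) x| <= e * h ^+ 2.
Proof.
move=> e0 df dDu; pose L : {linear V -> R^o} := 'd ('D_u f) x.
pose M := `|u| + `|v|; have M0 : 0 <= M by exact: addr_ge0.
(* The expansion of 'D_u f is used at two points of norm at most h * M, and each error gets a factor
   h. A tolerance of e / (2 * M + 1) thus gives at most e * h ^ 2; the + 1 covers M = 0. *)
have c0 : 0 < 2 * M + 1 by rewrite ltr_wpDl// mulr_ge0.
have /eqaddoP/(_ _ (divr_gt0 e0 c0)) near1 := diff_locally dDu.
have near2 : \forall k \near (0 : V), differentiable f (x + k).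
  by move: df; rewrite (near_shift 0 x)/=; apply: filterS => k; rewrite subr0 addrC.
have [d /= d0 dP] := (nbhs_ballP _ _).1 (filterI near1 near2).
near=> h.
have h0 : 0 < h by [].
have small k : `|k| <= h * (`|u| + `|v|) -> ball (0 : V) d k.
  move=> kh; rewrite -ball_normE /ball_/= sub0r normrN (le_lt_trans kh)//.
  rewrite (@le_lt_trans _ _ (h * (`|u| + `|v| + 1)))//.
    by rewrite ler_pM2l// lerDl.
  rewrite -ltr_pdivlMr; last by rewrite ltr_wpDl// addr_ge0.
  near: h; apply: nbhs_right_lt.
  by rewrite divr_gt0// ltr_wpDl// addr_ge0.
have s1 c : 0 <= c <= h -> `|c *: u + h *: v| <= h * (`|u| + `|v|).
  move=> /andP[c_ge0 ch]; rewrite (le_trans (ler_normD _ _))// !normrZ.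
  by rewrite mulrDr ger0_norm// (gtr0_norm h0) lerD2r ler_wpM2r.
have s2 c : 0 <= c <= h -> `|c *: u| <= h * (`|u| + `|v|).
  move=> /andP[c_ge0 ch]; rewrite normrZ ger0_norm// mulrDr.
  by rewrite ler_wpDr ?ler_wpM2r// mulr_ge0// ltW.
pose g (s : R) : R^o := f (s *: u + (h *: v + x)) - f (s *: u + x).
pose dg (s : R) : R^o := 'D_u f (s *: u + (h *: v + x)) - 'D_u f (s *: u + x).
have gd s : 0 <= s <= h -> is_derive s (1 : R) g (dg s).
  move=> sh; apply: is_deriveB; apply: has_deriv_line.
    by rewrite addrA addrC; apply: (dP _ (small _ (s1 _ sh))).2.
  by rewrite addrC; apply: (dP _ (small _ (s2 _ sh))).2.
have [] := @MVT _ g dg 0 h h0.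
- by move=> s; rewrite in_itv/= => /andP[/ltW s0 /ltW sh]; apply: gd; rewrite s0.
- apply: derivable_within_continuous => s; rewrite in_itv/= => sh.
  by have [] := gd s sh.
move=> c; rewrite in_itv/= => /andP[/ltW c_ge0 /ltW ch] gE.
have ch' : 0 <= c <= h by rewrite c_ge0.
have -> : second_difference f x u v h = dg c * h.
  rewrite -[X in _ * X](subr0 h) -gE /g /second_difference scale0r !add0r.
  have -> : h *: u + (h *: v + x) = x + h *: u + h *: v by rewrite addrA addrC addrA.
  by rewrite [h *: u + x]addrC [h *: v + x]addrC opprB addrA addrAC.
have := (dP _ (small _ (s1 _ ch'))).1; have := (dP _ (small _ (s2 _ ch'))).1.
have -> : dg c = 'D_u f (c *: u + h *: v + x) - 'D_u f (c *: u + x).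
  by rewrite /dg addrA.
have LE : L (c *: u + h *: v) = L (c *: u) + h * L v.
  by rewrite linearD; congr (_ + _); exact: linearZ.
rewrite !fctE /= -/L (deriveE v dDu) -/L LE.
set T1 := 'D_u f (_ + _ + _); set T0 := 'D_u f (_ + _); set a := 'D_u f x.
set l0 : R := L (c *: u); set l : R := L v.
have {}s1 := s1 _ ch'; have {}s2 := s2 _ ch'; rewrite -/M in s1 s2.
set K := e / _ => b0 b1.
have K0 : 0 < K by rewrite divr_gt0.
have KM : K * (2 * M) <= e.
  by rewrite -[leRHS](divfK (lt0r_neq0 c0)) -/K ler_pM2l// lerDl.
have -> : (T1 - T0) * h - h ^+ 2 * l =
    h * ((T1 - (a + (l0 + h * l))) - (T0 - (a + l0))) by ring.
rewrite normrM (gtr0_norm h0) expr2 mulrCA ler_pM2l//.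
rewrite (le_trans (ler_normB _ _))// (le_trans (lerD b1 b0))// -mulrDr.
rewrite (@le_trans _ _ (K * (h * (2 * M))))//.
  by rewrite ler_pM2l// mulrCA mulr_natl mulr2n lerD.
by rewrite mulrCA [e * _]mulrC ler_pM2l.
Unshelve. all: by end_near. Qed.

(** For a common small h > 0, the same second difference lies within (e / 2) * h ^ 2 of h ^ 2 times
    either mixed derivative. *)
Lemma schwarz (f : V -> R^o) x u v :
  (\forall y \near x, differentiable f y) ->
  differentiable ('D_u f) x -> differentiable ('D_v f) x ->
  'D_u ('D_v f) x = 'D_v ('D_u f) x.
Proof.
move=> df du dv; apply/eqP; rewrite -subr_eq0 -normr_eq0; apply/eqP/le_anti.
rewrite normr_ge0 andbT; apply/ler_addgt0Pr => e e0; rewrite add0r.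
have e20 : 0 < e / 2 by rewrite divr_gt0.
have nu := second_difference_near v e20 df du.
have nv := second_difference_near u e20 df dv.
have [h [h0 [eu ev]]] := @filter_ex _ _ _ _
  (@filterI _ _ _ _ _ (nbhs_right_gt (0 : R)) (@filterI _ _ _ _ _ nu nv)).
have h20 : 0 < h ^+ 2 by rewrite exprn_gt0.
rewrite -(ler_pM2l h20) -[X in X * `|_|](gtr0_norm h20) -normrM.
have sym : second_difference f x v u h = second_difference f x u v h.
  by rewrite /second_difference [x + h *: v + _]addrAC; congr (_ + _); exact: addrAC.
rewrite sym in ev; set a := 'D_u _ _ in ev *; set b := 'D_v _ _ in eu *.
set s := second_difference _ _ _ _ _ in eu ev.
have -> : h ^+ 2 * (a - b) = (s - h ^+ 2 * b) - (s - h ^+ 2 * a) by ring.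
rewrite (le_trans (ler_normB _ _))// (le_trans (lerD eu ev))//.
by rewrite -mulrDl -splitr mulrC.
Qed.

End Schwarz.

(** * Stability of C^k and smooth maps under the usual operations *)

Section CkCalculus.
Context {R : realType} {m : nat}.
Implicit Types U : set 'rV[R]_m.

Lemma open_near (T : topologicalType) (A : set T) (P : T -> Prop) x :
  open A -> A x -> (forall y, A y -> P y) -> \forall y \near x, P y.
Proof.
move=> oA Ax AP; have nA : nbhs x A by exact: open_nbhs_nbhs.
exact: filterS nA.
Qed.

Lemma Ck_ext {V : normedModType R} k U (f g : 'rV[R]_m -> V) :
  open U -> (forall x, U x -> f x = g x) -> Ck k U f -> Ck k U g.
Proof.
move=> oU; elim: k f g => [|k IH] f g fg /=.
  move=> cf x Ux; rewrite /prop_for /continuous_at -(fg x Ux).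
  apply: cvg_trans (cf x Ux); apply: (@near_eq_cvg _ _ _ (nbhs_filter x)).
  by apply: (open_near oU Ux) => y Uy; rewrite fg.
have near_fg x : U x -> \forall y \near x, f y = g y.
  by move=> Ux; exact: (open_near oU Ux).
move=> [df Cf]; split=> [x Ux|v].
  exact: near_eq_differentiable (near_fg x Ux) (df x Ux).
apply: IH (Cf v) => x Ux; apply: near_eq_derive; exact: near_fg.
Qed.

Lemma CkW {V : normedModType R} k U (f : 'rV[R]_m -> V) :
  Ck k.+1 U f -> Ck k U f.
Proof.
elim: k f => [|k IH] f [df Cf].
  by move=> x Ux; exact/differentiable_continuous/df.
by split=> // v; apply: IH.
Qed.

Lemma Ck_cst {V : normedModType R} k U (c : V) : Ck k U (fun=> c).
Proof.
elim: k c => [|k IH] c /=; first by move=> x _; exact: cst_continuous.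
split=> [x _|v]; first exact: differentiable_cst.
have -> : (fun x => 'D_v (fun=> c) x) = fun=> 0 by apply/funext => x; exact: derive_cst.
exact: IH.
Qed.

Lemma CkD k U (f g : 'rV[R]_m -> R^o) : open U ->
  Ck k U f -> Ck k U g -> Ck k U (fun x => f x + g x).
Proof.
move=> oU; elim: k f g => [|k IH] f g /=.
  by move=> cf cg x Ux; apply: continuousD; [exact: cf | exact: cg].
move=> [df Cf] [dg Cg]; have h v x (Ux : U x) :=
  has_derivD (conj (df x Ux) (erefl ('D_v f x))) (conj (dg x Ux) (erefl ('D_v g x))).
split=> [x Ux|v]; first by have [] := h 0 x Ux.
by apply: Ck_ext (IH _ _ (Cf v) (Cg v)) => // x Ux; have [_ ->] := h v x Ux.
Qed.

Lemma CkM k U (f g : 'rV[R]_m -> R^o) : open U ->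
  Ck k U f -> Ck k U g -> Ck k U (fun x => f x * g x : R^o).
Proof.
move=> oU; elim: k f g => [|k IH] f g.
  by move=> cf cg x Ux; apply: continuousM; [exact: cf | exact: cg].
move=> Cf' Cg'; have [df Cf] := Cf'; have [dg Cg] := Cg'.
have h v x (Ux : U x) :=
  has_derivM (conj (df x Ux) (erefl ('D_v f x))) (conj (dg x Ux) (erefl ('D_v g x))).
split=> [x Ux|v]; first by have [] := h 0 x Ux.
have H := CkD oU (IH _ _ (Cf v) (CkW Cg')) (IH _ _ (CkW Cf') (Cg v)).
by apply: Ck_ext H => // x Ux; have [_ ->] := h v x Ux.
Qed.

Lemma Ck_sum k U (I : Type) (r : seq I) (f : I -> 'rV[R]_m -> R^o) : open U ->
  (forall i, Ck k U (f i)) -> Ck k U (fun x => \sum_(i <- r) f i x).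
Proof.
move=> oU Cf; elim: r => [|i r IH].
  by under eq_fun do rewrite big_nil; exact: Ck_cst.
by under eq_fun do rewrite big_cons; exact: CkD.
Qed.

Lemma Ck_entry k U q (f : 'rV[R]_m -> 'rV[R]_q) j : open U ->
  Ck k U f -> Ck k U (fun x => f x 0 j : R^o).
Proof.
move=> oU; elim: k f => [|k IH] f /=.
  move=> cf x Ux; apply: (@continuous_comp _ _ _ f (fun M : 'rV[R]_q => M 0 j)).
    exact: cf.
  exact: coord_continuous.
move=> [df Cf]; split=> [x Ux|v].
  by have [] := has_deriv_entry 0 0 j (df x Ux).
apply: Ck_ext (IH _ (Cf v)) => // x Ux.
by have [_ ->] := has_deriv_entry v 0 j (df x Ux).
Qed.

(** One order is spent because continuity of a row vector is deduced from differentiability of its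
    coordinates. This costs nothing for [smooth_on], where all orders are available. *)
Lemma Ck_rV k U q (f : 'rV[R]_m -> 'rV[R]_q) : open U ->
  (forall j, Ck k.+1 U (fun x => f x 0 j : R^o)) -> Ck k U f.
Proof.
move=> oU; elim: k f => [|k IH] f Cf.
  move=> x Ux; apply/differentiable_continuous/differentiable_rV => j.
  by have [+ _] := Cf j; apply.
have df x : U x -> differentiable f x.
  by move=> Ux; apply: differentiable_rV => j; have [+ _] := Cf j; apply.
split=> // v; apply: IH => j; have H : Ck k.+1 U ('D_v (fun x => f x 0 j : R^o)) := (Cf j).2 v.
by apply: (Ck_ext oU _ H) => x Ux; have [_ ->] := has_deriv_entry v 0 j (df x Ux).
Qed.

End CkCalculus.

Lemma derive_sum_delta {R : realType} {m : nat} {V : normedModType R} (f : 'rV[R]_m -> V) x u :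
  differentiable f x -> 'D_u f x = \sum_b u 0 b *: 'D_(delta_mx 0 b) f x.
Proof.
move=> df; rewrite deriveE// {1}[u]row_sum_delta linear_sum.
by apply: eq_bigr => b _; rewrite deriveE// linearZ.
Qed.

Section CkComposition.
Context {R : realType} {m : nat}.
Implicit Types U : set 'rV[R]_m.

Lemma Ck_comp k U q (W : set 'rV[R]_q) (c : 'rV[R]_m -> 'rV[R]_q)
    (g : 'rV[R]_q -> R^o) : open U ->
  (forall x, U x -> W (c x)) -> Ck k U c -> Ck k W g -> Ck k U (g \o c).
Proof.
move=> oU cW; elim: k g => [|k IH] g.
  by move=> cc cg x Ux; apply: continuous_comp; [exact: cc | exact/cg/cW].
move=> Cc' [dg Cg]; have [dc Cc] := Cc'.
have h v x (Ux : U x) := has_deriv_comp v (dc x Ux) (dg _ (cW _ Ux)).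
split=> [x Ux|v]; first by have [] := h 0 x Ux.
(* In the chain rule the direction 'D_v c x varies with x, whereas [Ck] speaks of constant
   directions only; so it is expanded in the coordinate directions. *)
have H : Ck k U (fun x => \sum_b ('D_v c x) 0 b * 'D_(delta_mx 0 b) g (c x) : R^o).
  apply: Ck_sum => // b; apply: CkM => //; first exact: (Ck_entry _ oU (Cc v)).
  by apply: (IH (fun y => 'D_(delta_mx 0 b) g y) (CkW Cc')); exact: Cg.
apply: Ck_ext H => // x Ux; have [_ ->] := h v x Ux.
by rewrite (derive_sum_delta _ (dg _ (cW _ Ux))).
Qed.

Lemma smooth_on_comp U q p (W : set 'rV[R]_q) (c : 'rV[R]_m -> 'rV[R]_q)
    (g : 'rV[R]_q -> 'rV[R]_p) : open U -> open W ->
  (forall x, U x -> W (c x)) -> smooth_on U c -> smooth_on W g ->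
  smooth_on U (g \o c).
Proof.
move=> oU oW cW sc sg k; apply: Ck_rV => // j.
exact: (@Ck_comp _ _ _ W c (fun y => g y 0 j)) (sc _) (Ck_entry _ _ (sg _)).
Qed.

Lemma smooth_on_sub {V : normedModType R} U U' (f : 'rV[R]_m -> V) :
  U' `<=` U -> smooth_on U f -> smooth_on U' f.
Proof.
move=> UU' sf k; move: (sf k) => {sf}; elim: k f => [|k IH] f /=.
  by move=> cf x /UU'; exact: cf.
by move=> [df Cf]; split=> [x /UU'|v]; [exact: df | exact/IH/Cf].
Qed.

End CkComposition.

(** * Charts *)

Section Charts.
Context {R : realType} {m : nat} {N : manifold R m}.
Implicit Types p q : N.

Lemma chart_image p q : chart_dom N p q -> (chart p @` chart_dom N p) (chart p q).
Proof. by exists q. Qed.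

Lemma parK p x : (chart p @` chart_dom N p) x -> chart p (par p x) = x.
Proof. by move=> [q pq <-]; rewrite chartK. Qed.

Lemma par_chart p : par p (chart p p) = p.
Proof. by rewrite chartK//; exact: chart_dom_self. Qed.

Lemma near_par p q (P : N -> Prop) : chart_dom N p q ->
  (\forall r \near q, P r) -> \forall x \near chart p q, P (par p x).
Proof.
move=> pq Pq; have := @par_continuous _ _ N p _ (chart_image pq).
by rewrite /prop_for /continuous_at chartK//; apply.
Qed.

Lemma near_chart p q (P : 'rV[R]_m -> Prop) : chart_dom N p q ->
  (\forall x \near chart p q, P x) -> \forall r \near q, P (chart p r).
Proof. by move=> pq Px; have := chart_continuous pq; apply. Qed.

Lemma near_chart_dom p q : chart_dom N p q -> \forall r \near q, chart_dom N p r.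
Proof. by move=> pq; exact: (open_near (@chart_dom_open _ _ _ p) pq). Qed.

Lemma near_image p q : chart_dom N p q ->
  \forall x \near chart p q, (chart p @` chart_dom N p) x.
Proof. by move=> pq; exact: (open_near (@image_open _ _ _ p) (chart_image pq)). Qed.

Lemma near_smooth {V : normedModType R} p (Y : N -> V) : smooth_at p Y ->
  \forall x \near chart p p, differentiable (Y \o par p) x.
Proof. by move=> [U [oU Ux]] /(_ 1%N)[dY _]; exact: (open_near oU Ux). Qed.

Lemma smooth_derive {V : normedModType R} p (Y : N -> V) v : smooth_at p Y ->
  \forall x \near chart p p, differentiable ('D_v (Y \o par p)) x.
Proof. by move=> [U [oU Ux]] /(_ 2%N)[_ /(_ v)[dY _]]; exact: (open_near oU Ux). Qed.

Lemma smooth_differentiable {V : normedModType R} p (Y : N -> V) :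
  smooth_at p Y -> differentiable (Y \o par p) (chart p p).
Proof. by move=> /near_smooth/nbhs_singleton. Qed.

Definition transition p q := 'J (chart p \o par q) (chart q q).

Lemma transition_differentiable p q r : chart_dom N p r -> chart_dom N q r ->
  differentiable (chart p \o par q) (chart q r).
Proof.
move=> pr qr; have [+ _] := @transition_smooth _ _ N q p 1%N.
by apply; exists r.
Qed.

Lemma near_transition {V : Type} p q (Y : N -> V) : chart_dom N p q ->
  \forall y \near chart q q,
    (Y \o par p) ((chart p \o par q) y) = (Y \o par q) y.
Proof.
move=> pq; have qq := @chart_dom_self _ _ N q.
apply: filterS (near_par qq (near_chart_dom pq)) => y py /=.
by rewrite chartK.
Qed.

(** Derivatives at q are defined in the chart at q; this moves them to the chart at p, which stays
    fixed while q varies near p. *)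
Lemma has_deriv_transition {V : normedModType R} p q (Y : N -> V) v :
  chart_dom N p q -> differentiable (Y \o par p) (chart p q) ->
  has_deriv (Y \o par q) (chart q q) v
    ('D_(v *m transition p q) (Y \o par p) (chart p q)).
Proof.
move=> pq dY; have qq := @chart_dom_self _ _ N q.
have dc := transition_differentiable pq qq.
have pqE : (chart p \o par q) (chart q q) = chart p q by rewrite /= par_chart.
apply: near_eq_has_deriv (near_transition Y pq) _.
have dY' : differentiable (Y \o par p) ((chart p \o par q) (chart q q)) by rewrite pqE.
by have := has_deriv_comp v dc dY'; rewrite pqE (deriveEjacobian _ dc).
Qed.

(** The two chart changes compose to the identity near [chart q q], so their Jacobians are inverse
    to each other. *)
Lemma transition_unit p q : chart_dom N p q -> transition p q \in unitmx.
Proof.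
move=> pq; have qq := @chart_dom_self _ _ N q.
have dq := transition_differentiable qq pq.
suff : transition p q *m 'J (chart q \o par p) (chart p q) = 1%:M.
  move=> /mulmx1_unit[h _]; exact: h.
apply/row_matrixP => i; rewrite row_mul !rowE -(deriveEjacobian _ dq).
have [_ <-] := has_deriv_transition (delta_mx 0 i) pq dq.
rewrite mulmx1 -[RHS](derive_id (chart q q)).
apply: near_eq_derive; apply: filterS (near_image qq) => y yq.
exact: parK.
Qed.

Lemma jac_transition d (f : N -> 'rV[R]_d) p q :
  chart_dom N p q -> differentiable (f \o par p) (chart p q) ->
  jac f q = transition p q *m 'J (f \o par p) (chart p q).
Proof.
move=> pq df; apply/row_matrixP => i; rewrite row_mul !rowE /jac.
have [df' dE] := has_deriv_transition (delta_mx 0 i) pq df.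
by rewrite -(deriveEjacobian (_ *m _) df) -dE (deriveEjacobian _ df').
Qed.

End Charts.

Lemma smooth_at_comp {R : realType} {m k : nat} {N : manifold R m}
    {M : manifold R k} d (F : M -> 'rV[R]_d) (j : N -> M) p :
  {for p, continuous j} -> smooth_at p (chart (j p) \o j) -> smooth_at (j p) F ->
  smooth_at p (F \o j) /\
  jac (F \o j) p = jac (chart (j p) \o j) p *m jac F (j p).
Proof.
move=> cj [U [oU Ux] sU] [W [oW Wx] sW].
have pp := @chart_dom_self _ _ N p; have jj := @chart_dom_self _ _ M (j p).
pose c := chart (j p) \o j \o par p.
have cx : c (chart p p) = chart (j p) (j p) by rewrite /c /= par_chart.
have nearU : \forall x \near chart p p,
    [/\ U x, W (c x) & par (j p) (c x) = j (par p x)].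
  have dc : differentiable c (chart p p).
    by have [+ _] := sU 1%N; apply.
  have nW : \forall x \near chart p p, W (c x).
    have := differentiable_continuous dc; apply; rewrite /= cx.
    exact: open_nbhs_nbhs.
  have nj : \forall x \near chart p p, chart_dom M (j p) (j (par p x)).
    have nj0 : \forall r \near p, chart_dom M (j p) (j r) := cj _ (near_chart_dom jj).
    exact: (near_par pp nj0).
  have nU : \forall x \near chart p p, U x by exact: open_nbhs_nbhs.
  near=> x; split; [by near: x|by near: x|].
  by rewrite /c /= chartK//; near: x.
(* Smoothness is asked on an open set, hence the interior of the set where F \o j factors through
   [chart (j p)]. *)
have oU' := @open_interior _ [set x | [/\ U x, W (c x) & par (j p) (c x) = j (par p x)]].
set U' := _° in oU'.
have U'x : U' (chart p p) by exact: nearU.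
have U'P x : U' x -> [/\ U x, W (c x) & par (j p) (c x) = j (par p x)].
  by move=> /interior_subset.
have E x : U' x -> ((F \o par (j p)) \o c) x = ((F \o j) \o par p) x.
  by move=> /U'P[_ _ /= ->].
have sF : smooth_on U' ((F \o par (j p)) \o c).
  apply: (smooth_on_comp oU' oW _ _ sW); first by move=> x /U'P[].
  by apply: smooth_on_sub sU => x /U'P[].
split; first by exists U' => // k0; exact: Ck_ext oU' E (sF k0).
have dc : differentiable c (chart p p) by have [+ _] := sU 1%N; apply.
have dF : differentiable (F \o par (j p)) (c (chart p p)).
  by rewrite cx; have [+ _] := sW 1%N; apply.
apply/row_matrixP => i; rewrite row_mul !rowE /jac.
have [d1 dE] := has_deriv_comp (delta_mx 0 i) dc dF.
have nE := open_near oU' U'x E.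
have d2 := near_eq_differentiable nE d1.
rewrite -(deriveEjacobian (delta_mx 0 i) d2) -(deriveEjacobian (delta_mx 0 i) dc).
rewrite -cx -(deriveEjacobian ('D_(delta_mx 0 i) c _) dF) -dE.
by apply: near_eq_derive; apply: filterS nE => x ->.
Unshelve. all: by end_near. Qed.

(** * Transversal decomposition and second fundamental form *)

Section BracketCoordinates.
Context {R : realType} {n : nat}.
Implicit Types (A : 'M[R]_(n, n + 2)) (u v w : 'rV[R]_(n + 2)).

Lemma bracket_diag A u : bracket A u u = 0.
Proof.
have [|_ -> _] := @bracket_lin _ _ A u 0 u 0 1 0; last by rewrite mul0r.
by rewrite mul0mx add0r scale1r scale0r addr0.
Qed.

Lemma bracketC A u v : bracket A u v = - bracket A v u.
Proof.
have := bracket_diag A (u + 1 *: v).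
rewrite bracket_uZD !bracket_vZD !bracket_diag !mul1r add0r addr0.
by move/eqP; rewrite addr_eq0 => /eqP.
Qed.

Lemma bracket_set_row_u A i u v : bracket (set_row i u A) u v = 0.
Proof.
have /eqP := bracket_swap A i u v u.
by rewrite -addr_eq0 -mulr2n mulrn_eq0/= => /eqP.
Qed.

Lemma bracket_set_row_v A i u v : bracket (set_row i v A) u v = 0.
Proof. by rewrite bracketC bracket_set_row_u oppr0. Qed.

End BracketCoordinates.

Section TransverseCoordinates.
Context {R : realType} {n : nat} {N : manifold R n}.
Variable f : N -> 'rV[R]_(n + 2).
Variables xi eta : N -> 'rV[R]_(n + 2).
Implicit Types (p : N) (w : 'rV[R]_(n + 2)).

Definition transverse p := bracket (jac f p) (eta p) (xi p) != 0.

Lemma coordsE p w : transverse p ->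
  w = tan_part f xi eta p w + eta_part f xi eta p w *: eta p
      + xi_part f xi eta p w *: xi p.
Proof.
(* [coords] lists xi before eta, the bracket in [transverse] eta before xi; the determinants differ
   by a sign. *)
move=> tp; have uB : (col_mx (jac f p) (col_mx (xi p) (eta p)) : 'M[R]_(n + 2)) \in unitmx.
  by move: tp; rewrite /transverse bracketC oppr_eq0 unitmxE unitfE.
rewrite -{1}(mulmxKV uB w) -/(coords f xi eta p w) /tan_part /eta_part /xi_part.
rewrite -[coords f xi eta p w in LHS](@hsubmxK _ _ n (1 + 1)).
rewrite -[rsubmx (coords f xi eta p w) in LHS](@hsubmxK _ _ 1 1).
rewrite (@mul_row_col _ _ n (1 + 1)) (@mul_row_col _ _ 1 1) -addrA; congr (_ + _).
rewrite [lsubmx (rsubmx _) in LHS]mx11_scalar [rsubmx (rsubmx _) in LHS]mx11_scalar.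
by rewrite !mul_scalar_mx addrC.
Qed.

Lemma tan_part_sub p w : (tan_part f xi eta p w <= jac f p)%MS.
Proof. exact: submxMl. Qed.

Lemma eta_partP p b w w' :
  eta_part f xi eta p (b *: w + w') = b * eta_part f xi eta p w + eta_part f xi eta p w'.
Proof. by rewrite /eta_part /coords mulmxDl -scalemxAl !linearP !mxE. Qed.

Lemma eta_part0 p : eta_part f xi eta p 0 = 0.
Proof. by rewrite /eta_part /coords mul0mx !linear0 mxE. Qed.

Lemma eta_part_sum p (I : Type) (r : seq I) (c : I -> R) :
  forall w : I -> 'rV[R]_(n + 2), eta_part f xi eta p (\sum_(i <- r) c i *: w i) =
  \sum_(i <- r) c i * eta_part f xi eta p (w i).
Proof.
move=> w; elim: r => [|i r IH]; first by rewrite !big_nil eta_part0.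
by rewrite !big_cons eta_partP IH.
Qed.

Lemma bracket_parts p w : transverse p ->
  bracket (jac f p) w (xi p) =
    eta_part f xi eta p w * bracket (jac f p) (eta p) (xi p) /\
  bracket (jac f p) (eta p) w =
    xi_part f xi eta p w * bracket (jac f p) (eta p) (xi p).
Proof.
move=> /coordsE => /(_ w) wE; have /submxP[a aE] := tan_part_sub p w.
have := @bracket_lin _ _ (jac f p) (eta p) (xi p) w a
  (eta_part f xi eta p w) (xi_part f xi eta p w).
by rewrite -aE => /(_ wE)[-> -> _].
Qed.

(** The rows of A may be dependent, so this applies to arbitrary tangent fields and not only to
    frames. *)
Lemma bracket_eta_part p A w : transverse p -> (A <= jac f p)%MS ->
  bracket A w (xi p) = eta_part f xi eta p w * bracket A (eta p) (xi p).
Proof.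
move=> tp /submxP[P ->]; have [e _] := bracket_parts w tp.
by rewrite !bracket_mul e mulrCA.
Qed.

Lemma bracket_xi_part p A w : transverse p -> (A <= jac f p)%MS ->
  bracket A (eta p) w = xi_part f xi eta p w * bracket A (eta p) (xi p).
Proof.
move=> tp /submxP[P ->]; have [_ e] := bracket_parts w tp.
by rewrite !bracket_mul e mulrCA.
Qed.

(** The eta- and xi-components of w repeat a row of the determinant and so contribute nothing. *)
Lemma bracket_tan_part p A i w : transverse p ->
  bracket (set_row i w A) (eta p) (xi p) =
  bracket (set_row i (tan_part f xi eta p w) A) (eta p) (xi p).
Proof.
move=> tp; rewrite [in LHS](coordsE w tp) !bracket_rowZD.
by rewrite bracket_set_row_u bracket_set_row_v !mulr0 !addr0.
Qed.

End TransverseCoordinates.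

(** * Tangent fields in a fixed chart, and the form h^2 in coordinates *)

Section ImmersedManifold.
Context {R : realType} {n : nat} {N : manifold R n}.
Variable f : N -> 'rV[R]_(n + 2).
Hypothesis f_smooth : forall p, smooth_at p f.
Hypothesis f_free : forall p, row_free (jac f p).
Implicit Types p q : N.

Notation field := (N -> 'rV[R]_(n + 2)).

Definition chart_point p q :=
  chart_dom N p q /\ differentiable (f \o par p) (chart p q).

Lemma near_chart_point p : \forall q \near p, chart_point p q.
Proof.
have pp := @chart_dom_self _ _ N p.
exact: filterI (near_chart_dom pp) (near_chart pp (near_smooth (f_smooth p))).
Qed.

Notation J p q := ('J (f \o par p) (chart p q)).

Lemma jac_chart_point p q : chart_point p q -> jac f q = transition p q *m J p q.
Proof. by case; exact: jac_transition. Qed.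

Lemma eq_jac_chart_point p q : chart_point p q -> (jac f q :=: J p q)%MS.
Proof.
move=> pq; rewrite (jac_chart_point pq); apply: eqmxMfull.
by rewrite row_full_unit transition_unit//; case: pq.
Qed.

Lemma sub_chart_point p q (w : 'rV[R]_(n + 2)) : chart_point p q ->
  (w <= jac f q)%MS = (w <= J p q)%MS.
Proof. by move=> /eq_jac_chart_point e; exact: (e.2 _ w).2. Qed.

Lemma chart_jac_sub p q : chart_point p q -> (J p q <= jac f q)%MS.
Proof.
move=> pq; exact: unit_factor_sub (transition_unit pq.1) (jac_chart_point pq).
Qed.

Lemma free_chart_point p q : chart_point p q -> row_free (J p q).
Proof. by move=> pq; rewrite /row_free -(eq_jac_chart_point pq); exact: f_free. Qed.

Lemma pinv_chart_point p q (w : 'rV[R]_(n + 2)) : chart_point p q ->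
  (w <= jac f q)%MS ->
  w *m pinvmx (jac f q) *m transition p q = w *m pinvmx (J p q).
Proof.
move=> pq wq; exact: pinvmx_factor (f_free q) (free_chart_point pq)
  (jac_chart_point pq) wq.
Qed.

Lemma dir_deriv_chart {V : normedModType R} p q (X : field) (Y : N -> V) :
  chart_point p q -> (X q <= jac f q)%MS ->
  differentiable (Y \o par p) (chart p q) ->
  differentiable (Y \o par q) (chart q q) /\
  dir_deriv f X Y q = 'D_(X q *m pinvmx (J p q)) (Y \o par p) (chart p q).
Proof.
move=> pq Xq dY; rewrite -(pinv_chart_point pq Xq) /dir_deriv.
exact: (has_deriv_transition _ pq.1 dY).
Qed.

(** The tangent field with constant coordinates u in the chart at p. It extends any given tangent
    vector at p to a tangent field. *)
Definition cfield p (u : 'rV[R]_n) : field := fun q => u *m J p q.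

Lemma cfield_tangent p u : tangent_field f p (cfield p u).
Proof.
split; last first.
  apply: filterS (near_chart_point p) => q pq.
  by rewrite (eq_jac_chart_point pq); exact: submxMl.
have [U [oU Up] sU] := f_smooth p.
have oI := @image_open _ _ N p.
have pI := chart_image (@chart_dom_self _ _ N p).
exists (U `&` (chart p @` chart_dom N p)); first by split; [exact: openI | split].
have sD : smooth_on U ('D_u (f \o par p)) by move=> k; have [_] := sU k.+1; apply.
have sUI := smooth_on_sub (@subIsetl _ U (chart p @` chart_dom N p)) sD.
move=> k; apply: (Ck_ext (openI oU oI) _ (sUI k)) => x [Ux Ix].
have df : differentiable (f \o par p) x by have [+ _] := sU 1%N; apply.
by rewrite /cfield /= parK// (deriveEjacobian u df).
Qed.

(* Weaker than [tangent_field], so as to hold of [nabla X Y]. *)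
Definition diff_tangent p (Y : field) :=
  differentiable (Y \o par p) (chart p p) /\ \forall q \near p, (Y q <= jac f q)%MS.

Lemma diff_tangent_sub p Y : diff_tangent p Y -> (Y p <= jac f p)%MS.
Proof. by case=> _ /nbhs_singleton. Qed.

Lemma tangent_diff p Y : tangent_field f p Y -> diff_tangent p Y.
Proof. by case=> sY tY; split => //; exact: smooth_differentiable. Qed.

Lemma near_diff_tangent p Y : tangent_field f p Y -> \forall q \near p, diff_tangent q Y.
Proof.
move=> [sY tY]; have pp := @chart_dom_self _ _ N p.
have n1 := near_chart pp (near_smooth sY).
have n2 : \forall q \near p, \forall r \near q, (Y r <= jac f r)%MS.
  exact: nbhs_interior tY.
have n3 := near_chart_point p.
near=> q; split; last by near: q.
have pq : chart_dom N p q by have [] : chart_point p q by near: q.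
have dY : differentiable (Y \o par p) (chart p q) by near: q.
by have [] := has_deriv_transition 0 pq dY.
Unshelve. all: by end_near. Qed.

Lemma has_deriv_self {V : normedModType R} p (X : field) (Y : N -> V) :
  differentiable (Y \o par p) (chart p p) ->
  has_deriv (Y \o par p) (chart p p) (X p *m pinvmx (jac f p)) (dir_deriv f X Y p).
Proof. by move=> dY; split. Qed.

Variables xi eta : field.

(** By [h2E], the matrix of h^2 in the coordinate basis at p. Being built from second partial
    derivatives of f, it is visibly independent of any extension of vectors to fields. *)
Definition second_form p : 'M[R]_n := \matrix_(a, b) eta_part f xi eta p
  ('D_(delta_mx 0 a) (fun x => 'D_(delta_mx 0 b) (f \o par p) x) (chart p p)).

Lemma derive2_sym p u v :
  'D_u (fun y => 'D_v (f \o par p) y) (chart p p) =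
  'D_v (fun y => 'D_u (f \o par p) y) (chart p p).
Proof.
apply/rowP => k; set x := chart p p.
pose g : 'rV[R]_n -> R^o := fun y => f (par p y) 0 k.
have ndf := near_smooth (f_smooth p).
have comp w w' : has_deriv ('D_w g) x w' ('D_w' (fun y => 'D_w (f \o par p) y) x 0 k).
  have dw := nbhs_singleton (smooth_derive w (f_smooth p)).
  have h := has_deriv_entry w' 0 k dw.
  apply: near_eq_has_deriv h; apply: filterS ndf => y dy.
  by have [_ ->] := has_deriv_entry w 0 k dy.
have [du eu] := comp v u; have [dv ev] := comp u v.
have dg : \forall y \near x, differentiable g y.
  by apply: filterS ndf => y dy; have [] := has_deriv_entry 0 0 k dy.
exact: etrans (esym eu) (etrans (schwarz dg dv du) ev).
Qed.

Lemma second_form_sym p : (second_form p)^T = second_form p.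
Proof.
apply/matrixP => a b; rewrite [LHS]mxE [LHS]mxE [RHS]mxE.
by rewrite derive2_sym.
Qed.

(* Differentiate [bracket (J x) (Y x) (xi x) = 0], valid as Y is tangent. *)
Lemma h2E p (X Y : field) :
  transverse f xi eta p -> differentiable (xi \o par p) (chart p p) ->
  (X p <= jac f p)%MS -> diff_tangent p Y ->
  h2 f xi eta X Y p =
    (X p *m pinvmx (jac f p) *m second_form p *m (Y p *m pinvmx (jac f p))^T) 0 0.
Proof.
move=> tp dxi Xp dtY; have [dY tY] := dtY; have Yp := diff_tangent_sub dtY.
set u := X p *m _; set v := Y p *m _; set x := chart p p.
pose E (b : 'I_n) : 'rV[R]_n -> 'rV[R]_(n + 2) :=
  fun y => 'D_(delta_mx 0 b) (f \o par p) y.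
have hE b : has_deriv (E b) x u ('D_u (E b) x).
  by split=> //; exact: nbhs_singleton (smooth_derive _ (f_smooth p)).
pose hB := has_deriv_bracket hE (has_deriv_self X dY) (conj dxi (erefl ('D_u _ x))).
have nJ : \forall y \near x, \matrix_i E i y = 'J (f \o par p) y.
  apply: filterS (near_smooth (f_smooth p)) => y dy; apply/row_matrixP => i.
  by rewrite rowK rowE /E deriveEjacobian.
have n0 : \forall y \near x, bracket (\matrix_i E i y) ((Y \o par p) y) ((xi \o par p) y) = 0.
  have pp := @chart_dom_self _ _ N p.
  have n1 := near_par pp (near_chart_point p).
  have n2 := near_par pp tY.
  have n3 := near_image pp.
  near=> y; have -> : \matrix_i E i y = 'J (f \o par p) y by near: y.
  apply: bracket_sub_u => /=.
  have yI : (chart p @` chart_dom N p) y by near: y.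
  have -> : 'J (f \o par p) y = J p (par p y) by rewrite parK.
  rewrite -(eq_jac_chart_point (p := p)); last by near: y.
  by near: y.
have [_] := near_eq_has_deriv n0 hB.
have -> : 'D_u (fun=> 0 : R^o) x = 0 by exact: derive_cst.
rewrite (nbhs_singleton nJ) -/(jac f p) /comp /x par_chart -/x.
have YJ : Y p = v *m jac f p by rewrite /v mulmxKpV.
(* The term containing the derivative of xi still has the tangent vector Y p in the eta-slot, so it
   vanishes. *)
rewrite (bracket_sub_u _ Yp) addr0 => eq0.
set w := fun i => 'D_u (E i) x in eq0.
have rowE i : bracket (set_row i (w i) (jac f p)) (Y p) (xi p) =
    - (v 0 i * bracket (jac f p) (w i) (xi p)).
  rewrite bracket_swap; congr (- _).
  have := @bracket_lin _ _ (jac f p) (w i) (xi p) (Y p) v 0 0.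
  by rewrite !scale0r !addr0 => /(_ YJ)[_ _ ->].
have J_sub := submx_refl (jac f p).
have D0 : bracket (jac f p) (eta p) (xi p) != 0 by [].
rewrite (bracket_eta_part _ tp J_sub) in eq0.
have h2v : h2 f xi eta X Y p = \sum_i v 0 i * eta_part f xi eta p (w i).
  apply: (mulIf D0); move/eqP: eq0; rewrite eq_sym addrC addr_eq0 => /eqP ->.
  rewrite -sumrN mulr_suml; apply: eq_bigr => i _.
  by rewrite rowE opprK (bracket_eta_part _ tp J_sub) mulrA.
rewrite h2v mxE; apply: eq_bigr => b _; rewrite [v^T b 0]mxE mulrC; congr (_ * _).
have [dEb _] := hE b.
rewrite /w (derive_sum_delta u dEb) eta_part_sum mxE.
by apply: eq_bigr => a _; rewrite [second_form p a b]mxE.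
Unshelve. all: by end_near. Qed.

End ImmersedManifold.

(** * Differentiability of D_X Y and of its components *)

Section FieldDifferentiability.
Context {R : realType} {n : nat} {N : manifold R n}.
Variable f : N -> 'rV[R]_(n + 2).
Hypothesis f_smooth : forall p, smooth_at p f.
Hypothesis f_free : forall p, row_free (jac f p).
Variables (xi eta : N -> 'rV[R]_(n + 2)) (p : N).
Hypothesis xi_diff : differentiable (xi \o par p) (chart p p).
Hypothesis eta_diff : differentiable (eta \o par p) (chart p p).
Hypothesis near_transverse : \forall q \near p, transverse f xi eta q.

Notation field := (N -> 'rV[R]_(n + 2)).
Notation x0 := (chart p p).
Notation J x := ('J (f \o par p) x).

Let self := @chart_dom_self _ _ N p.

Lemma near_par_chart_point : \forall x \near x0,
  [/\ chart p (par p x) = x, chart_point f p (par p x) &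
      transverse f xi eta (par p x)].
Proof.
have n1 := near_image self.
have n2 := near_par self (near_chart_point f_smooth p).
have n3 := near_par self near_transverse.
near=> x; split; [apply: parK| |]; by near: x.
Unshelve. all: by end_near. Qed.

Lemma near_bracket_chart : \forall x \near x0,
  bracket (J x) (eta (par p x)) (xi (par p x)) != 0.
Proof.
apply: filterS near_par_chart_point => x [xE px].
rewrite /transverse (jac_chart_point px) xE bracket_mul.
by rewrite mulf_eq0 => /norP[].
Qed.

Let partial (b : 'I_n) (y : 'rV[R]_n) : 'rV[R]_(n + 2) :=
  'D_(delta_mx 0 b) (f \o par p) y.

Let partial_diff b : differentiable (partial b) x0.
Proof. exact: nbhs_singleton (smooth_derive _ (f_smooth p)). Qed.

Let near_partial : \forall x \near x0, \matrix_b partial b x = J x.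
Proof.
apply: filterS (near_smooth (f_smooth p)) => y dy; apply/row_matrixP => i.
by rewrite rowK [RHS]rowE /partial (deriveEjacobian _ dy).
Qed.

Let bracket_diff (Y Z : 'rV[R]_n -> 'rV[R]_(n + 2)) :
  differentiable Y x0 -> differentiable Z x0 ->
  differentiable ((fun x => bracket (J x) (Y x) (Z x)) : _ -> R^o) x0.
Proof.
move=> dY dZ.
have [h _] := has_deriv_bracket (fun b => conj (partial_diff b) (erefl ('D_0 _ _)))
  (conj dY (erefl ('D_0 _ _))) (conj dZ (erefl ('D_0 _ _))).
by apply: near_eq_differentiable h; apply: filterS near_partial => x ->.
Qed.

Let bracket_row_diff a (X : 'rV[R]_n -> 'rV[R]_(n + 2)) :
  differentiable X x0 ->
  differentiable ((fun x => bracket (set_row a (X x) (J x))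
    (eta (par p x)) (xi (par p x))) : _ -> R^o) x0.
Proof.
move=> dX; pose E b y := if b == a then X y else partial b y.
have dE b : differentiable (E b) x0.
  by rewrite /E; case: (b == a) => //; exact: partial_diff.
have [h _] := has_deriv_bracket (fun b => conj (dE b) (erefl ('D_0 _ _)))
  (conj eta_diff (erefl ('D_0 _ _))) (conj xi_diff (erefl ('D_0 _ _))).
apply: near_eq_differentiable h; apply: filterS near_partial => x Jx.
congr bracket; apply/row_matrixP => b.
by rewrite rowK row_set_row /E -Jx rowK.
Qed.

Let divr_bracket_diff (g : 'rV[R]_n -> R) :
  differentiable (g : _ -> R^o) x0 ->
  differentiable ((fun x => g x / bracket (J x) (eta (par p x)) (xi (par p x)))
    : _ -> R^o) x0.
Proof.
move=> dg; have dB := bracket_diff eta_diff xi_diff.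
have dV := differentiableV dB (nbhs_singleton near_bracket_chart).
exact: differentiableM dg dV.
Qed.

(** Near p, D_X Y is the sum of c_a D_a Y over the coordinate directions of the chart at p. The
    coordinates c_a of X, given through [pinvmx], become quotients of differentiable brackets by
    Cramer's rule. *)
Lemma dir_deriv_diff (X Y : field) :
  tangent_field f p X -> tangent_field f p Y ->
  differentiable (dir_deriv f X Y \o par p) x0.
Proof.
move=> tX tY; have dX := (tangent_diff tX).1.
pose c a x : R^o := bracket (set_row a (X (par p x)) (J x))
    (eta (par p x)) (xi (par p x)) / bracket (J x) (eta (par p x)) (xi (par p x)).
have dc a : differentiable (c a) x0.
  by apply: divr_bracket_diff; exact: (bracket_row_diff a dX).
pose Z a := 'D_(delta_mx 0 a) (Y \o par p).
have dZ a : differentiable (Z a) x0 := nbhs_singleton (smooth_derive _ tY.1).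
have dS : differentiable (fun x => \sum_a c a x *: Z a x) x0.
  apply: differentiable_rV => k.
  have -> : (fun x => (\sum_a c a x *: Z a x) 0 k : R^o) =
      (fun x => \sum_a c a x * Z a x 0 k).
    apply/funext => x; rewrite summxE; apply: eq_bigr => a _.
    by rewrite mxE.
  have h a := has_derivM (conj (dc a) (erefl ('D_0 _ _))) (has_deriv_entry 0 0 k (dZ a)).
  by have [] := has_deriv_sum (index_enum 'I_n) h.
apply: near_eq_differentiable dS.
have n1 := near_par self tX.2.
have n2 := near_smooth tY.1.
have n3 := near_bracket_chart.
have n4 := near_par_chart_point.
near=> x.
have [xE px _] : [/\ chart p (par p x) = x, chart_point f p (par p x) &
      transverse f xi eta (par p x)] by near: x.
have Xx : (X (par p x) <= jac f (par p x))%MS by near: x.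
have dYx : differentiable (Y \o par p) x by near: x.
have Bx : bracket (J x) (eta (par p x)) (xi (par p x)) != 0 by near: x.
have [|_ /= ->] := dir_deriv_chart f_free px Xx (Y := Y); first by rewrite xE.
rewrite xE (derive_sum_delta _ dYx); apply: eq_bigr => a _; congr (_ *: _).
rewrite /c; set u := X (par p x) *m _.
have XJ : (X (par p x) <= J (chart p (par p x)))%MS by rewrite -(sub_chart_point _ px).
rewrite xE in XJ.
have uE : X (par p x) = u *m J x := esym (mulmxKpV XJ).
have := @bracket_lin _ _ (J x) (eta (par p x)) (xi (par p x)) _ u 0 0.
by rewrite !scale0r !addr0 => /(_ _ uE)[_ _ ->]; rewrite mulfK.
Unshelve. all: by end_near. Qed.

(** The component does not depend on the basis of the tangent space, so the coordinate basis of the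
    chart at p may replace the one given by [jac f], leaving a quotient of differentiable
    brackets. *)
Lemma eta_part_diff (w : field) : differentiable (w \o par p) x0 ->
  differentiable ((fun x => eta_part f xi eta (par p x) (w (par p x))) : _ -> R^o) x0.
Proof.
move=> dw; apply: near_eq_differentiable (divr_bracket_diff (bracket_diff dw xi_diff)).
have n1 := near_bracket_chart.
have n2 := near_par_chart_point.
near=> x.
have [xE px tx] : [/\ chart p (par p x) = x, chart_point f p (par p x) &
      transverse f xi eta (par p x)] by near: x.
have Jx := chart_jac_sub px; rewrite xE in Jx.
have B0 : bracket (J x) (eta (par p x)) (xi (par p x)) != 0 by near: x.
exact: (canLR (mulfK B0) (bracket_eta_part _ tx Jx)).
Unshelve. all: by end_near. Qed.

Lemma xi_part_diff (w : field) : differentiable (w \o par p) x0 ->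
  differentiable ((fun x => xi_part f xi eta (par p x) (w (par p x))) : _ -> R^o) x0.
Proof.
move=> dw; apply: near_eq_differentiable (divr_bracket_diff (bracket_diff eta_diff dw)).
have n1 := near_bracket_chart.
have n2 := near_par_chart_point.
near=> x.
have [xE px tx] : [/\ chart p (par p x) = x, chart_point f p (par p x) &
      transverse f xi eta (par p x)] by near: x.
have Jx := chart_jac_sub px; rewrite xE in Jx.
have B0 : bracket (J x) (eta (par p x)) (xi (par p x)) != 0 by near: x.
exact: (canLR (mulfK B0) (bracket_xi_part _ tx Jx)).
Unshelve. all: by end_near. Qed.

(** The transversal components are subtracted from D_X Y. Differentiability is all that [h2E] and
    [volume_formE] ask of the result. *)
Lemma nabla_diff_tangent (X Y : field) :
  tangent_field f p X -> tangent_field f p Y ->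
  diff_tangent f p (nabla f xi eta X Y).
Proof.
move=> tX tY; have dD := dir_deriv_diff tX tY; split; last first.
  by apply: nearW => q; exact: tan_part_sub.
have he := eta_part_diff dD; have hx := xi_part_diff dD.
pose G x := dir_deriv f X Y (par p x) -
  (eta_part f xi eta (par p x) (dir_deriv f X Y (par p x)) *: eta (par p x) +
   xi_part f xi eta (par p x) (dir_deriv f X Y (par p x)) *: xi (par p x)).
have dG : differentiable G x0.
  apply: differentiable_rV => k.
  have e0 (g : 'rV[R]_n -> 'rV[R]_(n + 2)) : differentiable g x0 ->
      differentiable ((fun x => g x 0 k) : _ -> R^o) x0.
    by move=> dg; have [] := has_deriv_entry 0 0 k dg.
  have -> : (fun x => G x 0 k : R^o) = (fun x => dir_deriv f X Y (par p x) 0 k : R^o) -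
      ((fun x => eta_part f xi eta (par p x) (dir_deriv f X Y (par p x)) : R^o) *
         (fun x => eta (par p x) 0 k) +
       (fun x => xi_part f xi eta (par p x) (dir_deriv f X Y (par p x)) : R^o) *
         (fun x => xi (par p x) 0 k)).
    by apply/funext => x; rewrite !fctE /G !mxE.
  apply: differentiableB; first exact: e0 dD.
  by apply: differentiableD; apply: differentiableM => //; exact: e0.
apply: near_eq_differentiable dG; apply: filterS near_par_chart_point => x [_ _ tx].
by apply/eqP; rewrite /G subr_eq addrA; apply/eqP; exact: coordsE.
Qed.

End FieldDifferentiability.

(** * The affine metric is h^2 *)

(* With a, b the determinants of a positive frame and of a positive orthonormal
   frame in the coordinate basis, s that of the second fundamental form and d the
   bracket of the coordinate basis, the normalisation [b * d = 1] makes the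
   conformal factor between the affine metric and h^2 equal to 1. *)
Lemma conformal_factor_eq1 (R : realType) (n : nat) (a b d s : R) :
  s != 0 -> 0 < a * b -> b * d = 1 ->
  let c := a * d / `|(a * d) ^+ n * (a ^+ 2 * s)| `^ (n.+2%:R)^-1 in
  `|c ^+ n * (b ^+ 2 * s)| = 1 -> c = 1 /\ `|s| = d ^+ 2.
Proof.
move=> s0 ab bd c; set K := `|_| in c *.
have b0 : b != 0 by apply: contraTneq ab => ->; rewrite mulr0 ltxx.
have a0 : a != 0 by apply: contraTneq ab => ->; rewrite mul0r ltxx.
have db : d = b^-1 by apply: (mulfI b0); rewrite bd divff.
have d2 : 0 < d ^+ 2 by rewrite exprn_even_gt0//= db invr_eq0.
have ad : 0 < a * d.
  have -> : a * d = a * b * d ^+ 2 by rewrite expr2 mulrA -[a * b * d]mulrA bd mulr1.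
  exact: mulr_gt0.
have K0 : 0 < K.
  by rewrite normr_gt0 !mulf_neq0 ?expf_neq0// ?gt_eqF.
have c0 : 0 < c by rewrite divr_gt0// powR_gt0.
have cK : c ^+ n.+2 * K = (a * d) ^+ n.+2.
  have kn : (K `^ (n.+2%:R)^-1) ^+ n.+2 = K.
    by rewrite -powR_mulrn ?powR_ge0// -powRrM mulVf ?pnatr_eq0// powRr1 ?ltW.
  by rewrite /c expr_div_n kn divfK// gt_eqF.
have KE : K = (a * d) ^+ n * (a ^+ 2 * `|s|).
  have ad0 : 0 <= (a * d) ^+ n by rewrite exprn_ge0// ltW.
  by rewrite /K normrM (ger0_norm ad0) normrM (ger0_norm (sqr_ge0 a)).
have cn0 : 0 <= c ^+ n by rewrite exprn_ge0// ltW.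
rewrite normrM (ger0_norm cn0) normrM (ger0_norm (sqr_ge0 b)) => cn.
have c2s : c ^+ n.+2 * `|s| = d ^+ 2.
  have h : (a * d) ^+ n * a ^+ 2 != 0 by rewrite mulf_neq0 ?expf_neq0// gt_eqF.
  apply: (mulfI h); transitivity ((a * d) ^+ n.+2); last first.
    by rewrite -addn2 exprD -mulrA; congr (_ * _); rewrite exprMn.
  by rewrite -cK KE; ring.
have cns : c ^+ n * `|s| = d ^+ 2.
  have h : b ^+ 2 != 0 by rewrite expf_neq0.
  by apply: (mulfI h); rewrite mulrCA cn -exprMn bd expr1n.
have d0 : d ^+ 2 != 0 by rewrite gt_eqF.
have c21 : c ^+ 2 = 1.
  apply: (mulfI d0); rewrite mulr1 -{1}cns -c2s -[in RHS]addn2 exprD; ring.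
have c1 : c = 1 by apply/eqP; rewrite -(eqrXn2 (n := 2)) ?ltW// c21 expr1n.
by split=> //; rewrite -cns c1 expr1n mul1r.
Qed.

Section PointwiseMetric.
Context {R : realType} {n : nat} {N : manifold R n}.
Variable f : N -> 'rV[R]_(n + 2).
Hypothesis f_smooth : forall p, smooth_at p f.
Hypothesis f_free : forall p, row_free (jac f p).

Notation field := (N -> 'rV[R]_(n + 2)).

Definition cframe (p : N) (P : 'M[R]_n) (i : 'I_n) : field := cfield f p (row i P).

Lemma frame_cframe p q P : frame_mx (cframe p P) q = P *m 'J (f \o par p) (chart p q).
Proof. by apply/row_matrixP => i; rewrite rowK [RHS]row_mul. Qed.

Lemma cframe_local p P : P \in unitmx -> local_frame f p (cframe p P).
Proof.
move=> uP; split=> [i|]; first exact: cfield_tangent.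
apply: filterS (near_chart_point f_smooth p) => q pq; rewrite frame_cframe.
by rewrite row_free_mul ?uP// free_chart_point.
Qed.

Variables (xi eta : field) (p : N).
Hypothesis xi_diff : differentiable (xi \o par p) (chart p p).
Hypothesis p_transverse : transverse f xi eta p.
Hypothesis nondegenerate : forall X, tangent_field f p X ->
  (forall Y, tangent_field f p Y -> h2 f xi eta X Y p = 0) -> X p = 0.

Notation S := (second_form f xi eta p).
Notation D := (bracket (jac f p) (eta p) (xi p)).

(** The hypotheses on E and E' differ because only E' is differentiated; E enters through its values
    at p. *)
Lemma h2_mx p' q' (E : 'I_p' -> field) (E' : 'I_q' -> field) P P' i k :
  (forall i, E i p = row i P *m jac f p) -> 
  (forall i, diff_tangent f p (E' i)) ->
  (forall i, E' i p = row i P' *m jac f p) ->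
  h2 f xi eta (E i) (E' k) p = (P *m S *m P'^T) i k.
Proof.
move=> PE dE' PE'; rewrite (h2E f_smooth)//; last first.
  by rewrite PE submxMl.
rewrite PE PE' !(mulmxKp (f_free p)) tr_row -row_mul.
rewrite [LHS]mxE [RHS]mxE; apply: eq_bigr => l _.
by rewrite [row _ _ _ _]mxE [col _ _ _ _]mxE.
Qed.

(** A kernel vector, extended by [cfield] to a tangent field, would contradict non-degeneracy. *)
Lemma second_form_unit : S \in unitmx.
Proof.
rewrite unitmxE unitfE; apply/det0P => -[u u0 uS].
have tX := cfield_tangent f_smooth p u.
have Xp : cfield f p u p = u *m jac f p by [].
suff /nondegenerate : forall Y, tangent_field f p Y -> h2 f xi eta (cfield f p u) Y p = 0.
  move=> /(_ tX); rewrite Xp -(mul0mx _ (jac f p)) => /(row_free_inj (f_free p)) u0'.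
  by rewrite u0' eqxx in u0.
move=> Y tY; rewrite (h2E f_smooth) ?Xp ?submxMl//; last exact: tangent_diff.
by rewrite (mulmxKp (f_free p)) uS mul0mx mxE.
Qed.

Variable pos : N -> 'M[R]_(n, n + 2) -> bool.

Lemma basis_mul P : P \in unitmx -> basis_at f p (P *m jac f p).
Proof. by move=> uP; rewrite /basis_at row_free_mul ?uP ?submxMl. Qed.

Lemma basis_coord A : basis_at f p A ->
  exists2 P, P \in unitmx & A = P *m jac f p.
Proof.
move=> /andP[fA /submxP[P AE]]; exists P => //.
by move: fA; rewrite AE row_free_mul.
Qed.

Hypothesis n_gt0 : (0 < n)%N.
Hypothesis orient : forall A B, basis_at f p A -> basis_at f p B ->
  (pos p A == pos p B) = (0 < \det (B *m pinvmx A)).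
Hypothesis normalized : forall E, positive_frame f pos p E ->
  orthonormal_at f pos xi p E -> bracket (frame_mx E p) (eta p) (xi p) = 1.

(** The change of basis has determinant \det Q / \det P, which has the sign of the product. *)
Lemma orient_mul P Q : P \in unitmx -> Q \in unitmx ->
  (pos p (P *m jac f p) == pos p (Q *m jac f p)) = (0 < \det P * \det Q).
Proof.
move=> uP uQ; rewrite orient ?basis_mul//.
set X := _ *m pinvmx _.
have XP : X *m P = Q.
  apply: (row_free_inj (f_free p)); rewrite -mulmxA /X mulmxKpV//.
  have -> : Q = Q *m invmx P *m P by rewrite mulmxKV.
  by rewrite -mulmxA submxMl.
rewrite -XP det_mulmx mulrCA -expr2 pmulr_lgt0//.
by rewrite exprn_even_gt0//= -unitfE -unitmxE.
Qed.

(** Reversing the first vector of a basis changes its orientation but keeps it orthonormal. Such a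
    vector exists because n > 0. *)
Definition flip0 : 'M[R]_n := diag_mx (\row_i (-1) ^+ (val i == 0%N)).

Lemma det_flip0 : \det flip0 = -1.
Proof.
rewrite det_diag (bigD1 (Ordinal n_gt0))//= big1 ?mulr1 => [|i i0].
  by rewrite mxE expr1.
by rewrite mxE (_ : (val i == 0%N) = false) ?expr0//; exact: negbTE i0.
Qed.

Lemma exists_positive_sign (T : 'M[R]_n) : T^T = T -> T \in unitmx ->
  exists P, [/\ P \in unitmx, pos p (P *m jac f p) & forall i j,
    if i == j then `|(P *m T *m P^T) i j| = 1 else (P *m T *m P^T) i j = 0].
Proof.
move=> sT uT; have [P uP PT] := symmetric_congruent_sign sT uT.
have [posP|negP] := boolP (pos p (P *m jac f p)); first by exists P.
have uF : flip0 *m P \in unitmx.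
  by rewrite unitmx_mul uP andbT unitmxE det_flip0 unitrN1.
exists (flip0 *m P); split => //.
  have := orient_mul uP uF; rewrite det_mulmx det_flip0 mulN1r mulrN oppr_gt0.
  by rewrite (negbTE negP) -expr2 ltNge sqr_ge0; case: (pos _ (flip0 *m _ *m _)).
have -> : flip0 *m P *m T *m (flip0 *m P)^T = flip0 *m (P *m T *m P^T) *m flip0.
  by rewrite trmx_mul tr_diag_mx !mulmxA.
move=> i j; move: (PT i j); move: (P *m T *m P^T) => Q.
rewrite mul_mx_diag mul_diag_mx !mxE.
case: eqVneq => [->|_ ->]; last by rewrite mulr0 mul0r.
by rewrite !normrM !normrX normrN1 !expr1n mulr1 mul1r.
Qed.

(** Positive frames exist, so [xget] returns one of them and not its default, the zero family. *)
Lemma affine_metric_frame : exists2 E0, positive_frame f pos p E0 &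
  forall X Y, affine_metric f pos xi X Y p = metric_in f xi E0 X Y p.
Proof.
rewrite /affine_metric; set E0 := xget _ _; exists E0 => //.
have [P [uP posP _]] := exists_positive_sign (second_form_sym f_smooth xi eta p) second_form_unit.
apply: (@xgetPex _ _ [set E | positive_frame f pos p E]).
exists (cframe p P); split; first exact: cframe_local.
by rewrite frame_cframe.
Qed.

(** The second clause keeps what [volume_formE] needs: a positive basis of bracket 1 for the sign,
    and the value of |\det S| for the size. *)
Lemma affine_metricE :
  (forall X Y, (X p <= jac f p)%MS -> diff_tangent f p Y ->
     affine_metric f pos xi X Y p = h2 f xi eta X Y p) /\
  exists P, [/\ P \in unitmx, pos p (P *m jac f p), \det P * D = 1 & `|\det S| = D ^+ 2].
Proof.
have [E0 [[tE0 fE0] posE0] gE0] := affine_metric_frame.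
have [a ua E0a] : exists2 P, P \in unitmx & frame_mx E0 p = P *m jac f p.
  apply: basis_coord; rewrite /basis_at (nbhs_singleton fE0)/=.
  apply/row_subP => i; rewrite rowK.
  exact: diff_tangent_sub (tangent_diff (tE0 i)).
have E0i i : E0 i p = row i a *m jac f p by rewrite -row_mul -E0a rowK.
have th0 : bracket (frame_mx E0 p) (eta p) (xi p) = \det a * D.
  by rewrite E0a bracket_mul.
have E0sub : (frame_mx E0 p <= jac f p)%MS by rewrite E0a submxMl.
have GE X Y : G_in f xi E0 X Y p = h2 f xi eta X Y p * (\det a * D).
  by rewrite /G_in (bracket_eta_part _ p_transverse E0sub) th0.
(* In the frame E0, of matrix a in the coordinate basis, G is \det a * D times h^2; dividing by the
   root of its determinant gives the conformal factor c. *)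
pose c := \det a * D / `|(\det a * D) ^+ n * (\det a ^+ 2 * \det S)| `^ (n.+2%:R)^-1.
have detG : \det (\matrix_(i, j) G_in f xi E0 (E0 i) (E0 j) p) =
    (\det a * D) ^+ n * (\det a ^+ 2 * \det S).
  have -> : \matrix_(i, j) G_in f xi E0 (E0 i) (E0 j) p =
      (\det a * D) *: (a *m S *m a^T).
    apply/matrixP => i j; rewrite [LHS]mxE [RHS]mxE GE mulrC; congr (_ * _).
    by apply: h2_mx => // k; exact: tangent_diff.
  by rewrite detZ !det_mulmx det_tr; congr (_ * _); ring.
have metricE X Y : affine_metric f pos xi X Y p = c * h2 f xi eta X Y p.
  by rewrite gE0 /metric_in GE detG -[LHS]mulrA [LHS]mulrC.
have ua0 : \det a != 0 by rewrite -unitfE -unitmxE.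
have s0 : \det S != 0 by rewrite -unitfE -unitmxE second_form_unit.
have c_neq0 : c != 0.
  rewrite /c mulf_neq0 ?mulf_neq0// invr_eq0 powR_eq0 normr_eq0.
  by rewrite !mulf_eq0 !expf_eq0 !mulf_eq0 (negPf ua0) (negPf s0) (negPf p_transverse) !andbF.
have scS : (c *: S)^T = c *: S by rewrite linearZ/= second_form_sym.
have ucS : c *: S \in unitmx.
  by rewrite unitmxE detZ unitfE mulf_neq0 ?expf_neq0.
(* c *: S is the matrix of the affine metric, so b yields a positive orthonormal frame, to which the
   normalization of eta applies. *)
have [b [ub posb bS]] := exists_positive_sign scS ucS.
have Eb i : cframe p b i p = row i b *m jac f p by [].
have tb i : diff_tangent f p (cframe p b i).
  by apply: tangent_diff; exact: cfield_tangent.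
have bD : \det b * D = 1.
  rewrite -bracket_mul -(frame_cframe p p b); apply: normalized.
    by split; [exact: cframe_local | rewrite frame_cframe].
  move=> i k; rewrite metricE (h2_mx (P := b) (P' := b))//.
  have -> : c * (b *m S *m b^T) i k = (b *m (c *: S) *m b^T) i k.
    by rewrite -scalemxAr -scalemxAl [RHS]mxE.
  exact: bS.
have ab : 0 < \det a * \det b.
  by rewrite -orient_mul// -E0a posE0 posb.
have cb : `|c ^+ n * (\det b ^+ 2 * \det S)| = 1.
  have -> : c ^+ n * (\det b ^+ 2 * \det S) = \det (b *m (c *: S) *m b^T).
    by rewrite !det_mulmx det_tr detZ; ring.
  have /diag_mxP[t tE] : is_diag_mx (b *m (c *: S) *m b^T).
    by apply/is_diag_mxP => i j; have := bS i j; case: eqVneq => // ->; rewrite eqxx.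
  rewrite tE det_diag normr_prod big1// => i _.
  by have := bS i i; rewrite eqxx tE mxE eqxx mulr1n.
have [c1 sD] := conformal_factor_eq1 s0 ab bD cb; rewrite -/c in c1.
by split; [move=> X Y _ _; rewrite metricE c1 mul1r | exists b].
Qed.

(* Z need not be a frame: both sides vanish where it degenerates. *)
Lemma volume_formE (Z : 'I_n -> field) : (forall i, diff_tangent f p (Z i)) ->
  volume_form f pos xi Z p = bracket (frame_mx Z p) (eta p) (xi p).
Proof.
move=> tZ; have [gE [b [ub posb bD sD]]] := affine_metricE.
have Zsub i := diff_tangent_sub (tZ i).
pose P := frame_mx Z p *m pinvmx (jac f p).
have ZP : frame_mx Z p = P *m jac f p.
  by rewrite /P mulmxKpV//; apply/row_subP => i; rewrite rowK.
have Zi i : Z i p = row i P *m jac f p by rewrite -row_mul -ZP rowK.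
rewrite /volume_form.
have -> : \matrix_(i, k) affine_metric f pos xi (Z i) (Z k) p = P *m S *m P^T.
  by apply/matrixP => i k; rewrite mxE gE//; exact: h2_mx.
rewrite !det_mulmx det_tr mulrAC -expr2 normrM sD ger0_norm ?sqr_ge0//.
rewrite -exprMn sqrtr_sqr ZP bracket_mul.
have [->|P0] := eqVneq (\det P) 0; first by rewrite !mul0r normr0 mulr0.
have uP : P \in unitmx by rewrite unitmxE unitfE.
have := orient_mul ub uP; rewrite posb eq_sym eqb_id => ->.
have b0 : \det b != 0 by rewrite -unitfE -unitmxE.
have DE : D = (\det b)^-1 by apply: (mulfI b0); rewrite bD divff.
(* D is the inverse of \det b, so being positively oriented means having a positive bracket with eta
   and xi. *)
have -> : (0 < \det b * \det P) = (0 < \det P * D).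
  have b2 : 0 < \det b ^+ 2 by rewrite exprn_even_gt0.
  rewrite -[RHS](pmulr_rgt0 _ b2) DE; congr (0 < _).
  by rewrite expr2 -mulrA; congr (_ * _); rewrite mulrCA mulfV// mulr1.
have PD0 : \det P * D != 0 by rewrite mulf_neq0.
case: ltP => [/gtr0_norm ->|/ler0_norm ->]; first by rewrite mul1r.
by rewrite mulN1r opprK.
Qed.

End PointwiseMetric.

(** * Covariant derivatives of the volume form and of the metric *)

Section PointwiseEquivalence.
Context {R : realType} {n : nat} {N : manifold R n}.
Variable f : N -> 'rV[R]_(n + 2).
Hypothesis f_smooth : forall p, smooth_at p f.
Hypothesis f_free : forall p, row_free (jac f p).

Notation field := (N -> 'rV[R]_(n + 2)).

Variables (xi eta : field) (pos : N -> 'M[R]_(n, n + 2) -> bool) (p : N).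
Hypothesis xi_diff : forall q, differentiable (xi \o par q) (chart q q).
Hypothesis eta_diff : differentiable (eta \o par p) (chart p p).
Hypothesis near_transverse : \forall q \near p, transverse f xi eta q.
Hypothesis tau12_eq0 : forall X, tangent_field f p X -> tau12 f xi eta X p = 0.
Hypothesis tau22_eq0 : forall X, tangent_field f p X -> tau22 f xi eta X p = 0.
Hypothesis near_volume : \forall q \near p, forall Z : 'I_n -> field,
  (forall i, diff_tangent f q (Z i)) ->
  volume_form f pos xi Z q = bracket (frame_mx Z q) (eta q) (xi q).
Hypothesis near_det_second_form : \forall q \near p,
  `|\det (second_form f xi eta q)| = bracket (jac f q) (eta q) (xi q) ^+ 2.
Hypothesis second_form_p_unit : second_form f xi eta p \in unitmx.

Notation x0 := (chart p p).
Let self := @chart_dom_self _ _ N p.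
Let transverse_p : transverse f xi eta p := nbhs_singleton near_transverse.

Definition tau11 (X : field) := xi_part f xi eta p (dir_deriv f X xi p).

Lemma frame_sub (Z : 'I_n -> field) q :
  (forall i, (Z i q <= jac f q)%MS) -> (frame_mx Z q <= jac f q)%MS.
Proof. by move=> Zq; apply/row_subP => i; rewrite rowK. Qed.

Lemma has_deriv_bracket_frame (X : field) (Z : 'I_n -> field) :
  tangent_field f p X -> (forall i, tangent_field f p (Z i)) ->
  has_deriv ((fun x => bracket (frame_mx Z (par p x)) (eta (par p x)) (xi (par p x)))
      : _ -> R^o) x0 (X p *m pinvmx (jac f p))
    (\sum_i bracket (set_row i (nabla f xi eta X (Z i) p) (frame_mx Z p)) (eta p) (xi p)
     + tau11 X * bracket (frame_mx Z p) (eta p) (xi p)).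
Proof.
move=> tX tZ; have dZ i := (tangent_diff (tZ i)).1.
have h := has_deriv_bracket (fun i => has_deriv_self f X (dZ i))
  (has_deriv_self f X eta_diff) (has_deriv_self f X (xi_diff p)).
have Zsub : (frame_mx Z p <= jac f p)%MS.
  by apply: frame_sub => i; exact: diff_tangent_sub (tangent_diff (tZ i)).
move: h; congr has_deriv; rewrite /comp /x0 par_chart.
rewrite (bracket_eta_part (dir_deriv f X eta p) transverse_p Zsub).
rewrite (bracket_xi_part (dir_deriv f X xi p) transverse_p Zsub).
rewrite -/(tau22 f xi eta X p) (tau22_eq0 tX) mul0r addr0; congr (_ + _).
by apply: eq_bigr => i _; exact: bracket_tan_part transverse_p.
Qed.

Lemma nabla_volume_form (X : field) (Z : 'I_n -> field) :
  tangent_field f p X -> (forall i, tangent_field f p (Z i)) ->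
  nabla_formn f xi eta (volume_form f pos xi) X Z p =
  tau11 X * bracket (frame_mx Z p) (eta p) (xi p).
Proof.
move=> tX tZ; rewrite /nabla_formn.
have [_ dE] := has_deriv_bracket_frame tX tZ.
have dtZ : \forall q \near p, forall i, diff_tangent f q (Z i).
  by apply: filter_forall => i; exact: near_diff_tangent.
have -> : dir_deriv f X (volume_form f pos xi Z : N -> R^o) p =
    'D_(X p *m pinvmx (jac f p)) ((fun x => bracket (frame_mx Z (par p x))
      (eta (par p x)) (xi (par p x))) : _ -> R^o) x0.
  have n1 := near_par self dtZ; have n2 := near_par self near_volume.
  apply: near_eq_derive; near=> x => /=.
  have tZx : forall i, diff_tangent f (par p x) (Z i) by near: x.
  by apply: (near n2 x _) tZx.
rewrite dE addrAC -[RHS]add0r; congr (_ + _); apply/eqP; rewrite subr_eq0; apply/eqP.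
(* The inserted field nabla X (Z i) is only known to be [diff_tangent], which is why [near_volume]
   is stated for such fields. *)
apply: eq_bigr => i _; rewrite (nbhs_singleton near_volume) => [|k]; last first.
  case: eqP => _; last exact: tangent_diff.
  exact: (nabla_diff_tangent f_smooth f_free (xi_diff p) eta_diff near_transverse tX (tZ i)).
congr bracket; apply/row_matrixP => k; rewrite row_set_row !rowK.
by case: eqP.
Unshelve. all: by end_near. Qed.

Lemma trace_cubic_form (X : field) (E : 'I_n -> field) :
  tangent_field f p X -> local_frame f p E ->
  \tr (invmx (\matrix_(i, j) h2 f xi eta (E i) (E j) p) *m
       \matrix_(i, j) cubic_form f xi eta X (E i) (E j) p) = 2 * tau11 X.
Proof.
move=> tX [tE fE]; set v := X p *m pinvmx (jac f p).
pose H q := \matrix_(i, j) h2 f xi eta (E i) (E j) q.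
(* [co q] depends on the chart at q and is only used pointwise; the functions to be differentiated
   are the entries of H and [th]. *)
pose co q := frame_mx E q *m pinvmx (jac f q).
pose th x := bracket (frame_mx E (par p x)) (eta (par p x)) (xi (par p x)).
have dtE : \forall q \near p, forall i, diff_tangent f q (E i).
  by apply: filter_forall => i; exact: near_diff_tangent.
have coE q i : (forall i, diff_tangent f q (E i)) ->
    E i q = row i (co q) *m jac f q.
  move=> dE; rewrite -row_mul /co mulmxKpV ?rowK//.
  by apply: frame_sub => k; exact: diff_tangent_sub.
have HE q : (forall i, diff_tangent f q (E i)) -> transverse f xi eta q ->
    H q = co q *m second_form f xi eta q *m (co q)^T.
  move=> dE tq; apply/matrixP => i k; rewrite [LHS]mxE.
  by apply: h2_mx => // l; exact: coE.
have frE q : (forall i, diff_tangent f q (E i)) -> frame_mx E q = co q *m jac f q.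
  by move=> dE; apply/row_matrixP => i; rewrite rowK row_mul -coE.
(* The squares avoid following the sign of [\det H]. *)
have detH2 : \forall x \near x0, \det (H (par p x)) * \det (H (par p x)) =
    (th x * th x) * (th x * th x).
  have n1 := near_par self dtE; have n2 := near_par self near_transverse.
  have n3 := near_par self near_det_second_form.
  near=> x; have dx : forall i, diff_tangent f (par p x) (E i) by near: x.
  have tx : transverse f xi eta (par p x) by near: x.
  have sx : `|\det (second_form f xi eta (par p x))| =
    bracket (jac f (par p x)) (eta (par p x)) (xi (par p x)) ^+ 2 by near: x.
  rewrite (HE _ dx tx) /th (frE _ dx) bracket_mul !det_mulmx det_tr.
  have s2 : \det (second_form f xi eta (par p x)) ^+ 2 =
      bracket (jac f (par p x)) (eta (par p x)) (xi (par p x)) ^+ 4.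
    by rewrite -real_normK ?num_real// sx -exprM.
  move: s2; set s := \det (second_form _ _ _ _); set b := bracket _ _ _; set a := \det _.
  move=> s2; transitivity (a ^+ 4 * s ^+ 2); first by ring.
  by rewrite s2; ring.
have dE0 := nbhs_singleton dtE.
have dH i j : has_deriv ((fun x => H (par p x) i j) : _ -> R^o) x0 v
    (dir_deriv f X (h2 f xi eta (E i) (E j) : N -> R^o) p).
  have -> : (fun x => H (par p x) i j : R^o) = h2 f xi eta (E i) (E j) \o par p.
    by apply/funext => x; rewrite mxE.
  apply: (has_deriv_self f X); apply: (eta_part_diff f_smooth (xi_diff p)) => //.
  exact: (dir_deriv_diff f_smooth f_free (xi_diff p) eta_diff near_transverse (tE i) (tE j)).
pose dHm := \matrix_(i, j) dir_deriv f X (h2 f xi eta (E i) (E j) : N -> R^o) p.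
have dT : has_deriv ((fun x => \det (H (par p x))) : _ -> R^o) x0 v
    (\sum_i \det (set_row i (row i dHm) (H p))).
  have := @has_deriv_det _ _ _ (fun x => H (par p x)) x0 v dHm.
  by rewrite par_chart; apply => i j; rewrite [dHm i j]mxE.
have dth := has_deriv_bracket_frame tX tE; rewrite -/v -/th in dth.
have [_ e2] := near_eq_has_deriv detH2 (has_derivM dT dT).
have [_ e3] := has_derivM (has_derivM dth dth) (has_derivM dth dth).
have detH2p := nbhs_singleton detH2.
have [P [frEp HEp EP]] : exists P, [/\ frame_mx E p = P *m jac f p,
    H p = P *m second_form f xi eta p *m P^T & forall k, E k p = row k P *m jac f p].
  by exists (co p); split=> [||k]; [exact: frE|exact: HE|exact: coE].
have uP : P \in unitmx by have := nbhs_singleton fE; rewrite frEp row_free_mul.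
have uH : H p \in unitmx by rewrite HEp !unitmx_mul unitmx_tr uP second_form_p_unit.
pose nab i := nabla f xi eta X (E i).
pose G := \matrix_i (nab i p *m pinvmx (jac f p) *m invmx P).
have nabE i : nab i p = row i (G *m P) *m jac f p.
  have nab_sub : (nab i p <= jac f p)%MS by exact: tan_part_sub.
  by rewrite row_mul rowK (mulmxKV uP) (mulmxKpV nab_sub).
set b := bracket (frame_mx E p) (eta p) (xi p) in dth e2 e3 *.
have thE : th x0 = b by rewrite /th par_chart.
have b0 : b != 0.
  by rewrite /b frEp bracket_mul mulf_neq0// -unitfE -unitmxE.
have sumG : \sum_i bracket (set_row i (nab i p) (frame_mx E p)) (eta p) (xi p) = \tr G * b.
  rewrite /mxtrace mulr_suml; apply: eq_bigr => i _.
  have := @bracket_lin _ _ (frame_mx E p) (eta p) (xi p) (nab i p) (row i G) 0 0.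
  have e : nab i p = row i G *m frame_mx E p by rewrite frEp mulmxA -row_mul -nabE.
  rewrite !scale0r !addr0 => /(_ e)[_ _ ->].
  by rewrite [row i G 0 i]mxE.
pose r := \tr (dHm *m invmx (H p)).
(* Jacobi's formula: by Cramer's rule in each row, r is the logarithmic derivative of \det H. *)
have sumH : \sum_i \det (set_row i (row i dHm) (H p)) = r * \det (H p).
  rewrite /r /mxtrace mulr_suml; apply: eq_bigr => i _.
  have -> : row i dHm = row i (dHm *m invmx (H p)) *m H p.
    by rewrite -row_mul mulmxKV.
  by rewrite det_set_row [row i _ 0 i]mxE.
(* Differentiating [detH2] gives 2 r T^2 = 4 (\tr G + tau11 X) b^4, and T^2 = b^4 is nonzero. *)
have rE : r = 2 * (\tr G + tau11 X).
  move: e2 e3; rewrite sumH sumG thE par_chart => -> e4.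
  rewrite par_chart thE in detH2p; set T := \det (H p) in e4 detH2p.
  have TT0 : T * T != 0 by rewrite detH2p !mulf_neq0.
  apply: (mulIf TT0); apply: (@mulfI _ 2); first by rewrite pnatr_eq0.
  transitivity (r * T * T + T * (r * T)); first by ring.
  by rewrite e4 detH2p; ring.
have CE : \matrix_(i, j) cubic_form f xi eta X (E i) (E j) p =
    dHm - G *m H p - H p *m G^T.
  apply/matrixP => i j; rewrite [LHS]mxE [RHS]mxE [X in _ = X + _]mxE.
  rewrite [(- (_ *m _)) i j]mxE [(- (_ *m _)) i j]mxE [dHm i j]mxE.
  rewrite /cubic_form (tau12_eq0 tX) (tau22_eq0 tX) !mul0r !addr0 /nabla_form2.
  have tn k : diff_tangent f p (nab k).
    exact: (nabla_diff_tangent f_smooth f_free (xi_diff p) eta_diff near_transverse tX (tE k)).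
  have -> : h2 f xi eta (nabla f xi eta X (E i)) (E j) p = (G *m H p) i j.
    rewrite HEp !mulmxA; exact: (h2_mx f_smooth f_free (xi_diff p) transverse_p i j nabE dE0 EP).
  have -> : h2 f xi eta (E i) (nabla f xi eta X (E j)) p = (H p *m G^T) i j.
    rewrite HEp -mulmxA -trmx_mul; exact: (h2_mx f_smooth f_free (xi_diff p) transverse_p i j EP tn nabE).
  by [].
have t1 : \tr (invmx (H p) *m (G *m H p)) = \tr G.
  by rewrite mxtrace_mulC -mulmxA mulmxV// mulmx1.
have t2 : \tr (invmx (H p) *m (H p *m G^T)) = \tr G.
  by rewrite mulmxA mulVmx// mul1mx mxtrace_tr.
have t3 : \tr (invmx (H p) *m dHm) = r by rewrite mxtrace_mulC.
rewrite CE -/(H p) !mulmxBr.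
by rewrite 2!(raddfB (@mxtrace R n))/= t1 t2 t3 rE; ring.
Unshelve. all: by end_near. Qed.

Lemma tau11_eq0_apolar :
  (forall X, tangent_field f p X -> tau11 X = 0) <-> apolar_at f xi eta p.
Proof.
split=> [t0 X E tX lE|ap X tX]; first by rewrite trace_cubic_form// t0// mulr0.
have lE := cframe_local f_smooth f_free p (unitmx1 R n).
have := ap X _ tX lE; rewrite trace_cubic_form// => /eqP.
by rewrite mulf_eq0 pnatr_eq0/= => /eqP.
Qed.

Lemma tau11_eq0_equiaffine :
  (forall X, tangent_field f p X -> tau11 X = 0) <-> equiaffine_at f pos xi eta p.
Proof.
split=> [t0 X Z tX tZ|eq X tX]; first by rewrite nabla_volume_form// t0// mul0r.
have [tE _] := cframe_local f_smooth f_free p (unitmx1 R n).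
have /eqP := eq X _ tX tE; rewrite nabla_volume_form// mulf_eq0 => /orP[/eqP//|].
by rewrite frame_cframe mul1mx (negPf transverse_p).
Qed.

Lemma tau11_eq0_parallel :
  (forall X, tangent_field f p X -> tau11 X = 0) <-> parallel_at f xi p.
Proof.
split=> [t0 X tX|par_xi X tX].
  rewrite (coordsE (dir_deriv f X xi p) transverse_p).
  rewrite -/(tau12 f xi eta X p) -/(tau11 X) tau12_eq0// t0// !scale0r !addr0.
  exact: tan_part_sub.
have := bracket_xi_part (dir_deriv f X xi p) transverse_p (submx_refl _).
rewrite (bracket_sub_v _ (par_xi X tX)) -/(tau11 X) => /esym/eqP.
by rewrite mulf_eq0 (negPf transverse_p) orbF => /eqP.
Qed.

End PointwiseEquivalence.

(** * Submanifolds of a hypersurface *)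

Section HypersurfaceGeometry.
Context {R : realType} {n : nat} {M : manifold R n.+1} {N : manifold R n}.
Variables (F : M -> 'rV[R]_(n + 2)) (j : N -> M).
Hypothesis F_immersion : immersion_vec F.
Hypothesis j_immersion : immersion j.

Notation f := (F \o j).
Notation field := (N -> 'rV[R]_(n + 2)).

Lemma comp_immersion : immersion_vec f.
Proof.
move=> p; have [cj sj fj] := j_immersion p; have [sF fF] := F_immersion (j p).
have [sf ->] := smooth_at_comp cj sj sF; split=> //.
by rewrite /row_free mxrankMfree.
Qed.

Lemma jac_comp_sub p : (jac f p <= jac F (j p))%MS.
Proof.
have [cj sj fj] := j_immersion p; have [sF fF] := F_immersion (j p).
by have [_ ->] := smooth_at_comp cj sj sF; exact: submxMl.
Qed.

Variables (xi eta : field) (p : N).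
Hypothesis xi_tangent : tangent_M F j p (xi p).
Hypothesis xi_transversal : ~~ (xi p <= jac f p)%MS.

(** A dimension count: T_pN and xi together have rank greater than n inside the (n + 1)-dimensional
    tangent space of M. *)
Lemma tangent_M_span w : tangent_M F j p w -> (w <= col_mx (jac f p) (xi p))%MS.
Proof.
set A := col_mx _ _ => wT; have [_ fF] := F_immersion (j p).
have [_ ff] := comp_immersion p.
have AT : (A <= jac F (j p))%MS by rewrite col_mx_sub jac_comp_sub.
have JA : (jac f p <= A)%MS by rewrite -addsmxE addsmxSl.
have xiA : (xi p <= A)%MS by rewrite -addsmxE addsmxSr.
have rA : (n < \rank A)%N.
  rewrite ltnNge -[n in (_ <= n)%N](eqP ff) (geq_leqif (mxrank_leqif_sup JA)).
  by apply: contra xi_transversal; exact: submx_trans.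
apply: submx_trans wT _; rewrite -(geq_leqif (mxrank_leqif_sup AT)).
by rewrite (eqP fF).
Qed.

(** This turns tangency to M into the absence of an eta-component. Applied to D_X xi and D_X eta, it
    yields the vanishing of [tau12] and [tau22]. *)
Lemma tangent_M_eta_part w : transverse f xi eta p -> tangent_M F j p w ->
  eta_part f xi eta p w = 0.
Proof.
move=> tp /tangent_M_span/submxP[c wE].
have := @bracket_lin _ _ (jac f p) (eta p) (xi p) w (lsubmx c) 0 (rsubmx c 0 0).
rewrite scale0r addr0 => -[|e _ _].
  by rewrite wE -{1}[c]hsubmxK mul_row_col {1}[rsubmx c]mx11_scalar mul_scalar_mx.
apply/eqP; move: e; rewrite (bracket_eta_part _ tp (submx_refl _)) mul0r => /eqP.
by rewrite mulf_eq0 (negPf tp) orbF.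
Qed.

(** In a linear relation, the coefficient of eta vanishes because eta leaves T_pM, then that of xi
    because xi leaves T_pN, and the rest because f is an immersion. *)
Lemma adapted_transverse : ~~ tangent_M F j p (eta p) -> transverse f xi eta p.
Proof.
move=> eta_transversal; have [_ ff] := comp_immersion p.
apply/negP => /det0P[v v0 vA].
pose a := lsubmx (v : 'rV_(n + (1 + 1))).
pose b := lsubmx (rsubmx (v : 'rV_(n + (1 + 1)))) 0 0.
pose c := rsubmx (rsubmx (v : 'rV_(n + (1 + 1)))) 0 0.
have vE : v = row_mx a (row_mx b%:M c%:M) :> 'rV_(n + (1 + 1)).
  by rewrite -!mx11_scalar !hsubmxK.
have {vA} vA : a *m jac f p + (b *: eta p + c *: xi p) = 0.
  rewrite -vA vE (@mul_row_col _ _ n (1 + 1)) (@mul_row_col _ _ 1 1).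
  by rewrite !mul_scalar_mx.
have b0 : b = 0.
  apply: contraNeq eta_transversal => b0.
  have -> : eta p = - b^-1 *: (a *m jac f p + c *: xi p).
    move/eqP: vA; rewrite addrCA addr_eq0 => /eqP e.
    by rewrite scaleNr -scalerN -e scalerA mulVf// scale1r.
  rewrite /tangent_M scalemx_sub// addmx_sub ?scalemx_sub//.
  exact: submx_trans (submxMl _ _) (jac_comp_sub p).
have c0 : c = 0.
  apply: contraNeq xi_transversal => c0.
  have -> : xi p = - c^-1 *: (a *m jac f p).
    move/eqP: vA; rewrite b0 scale0r add0r addr_eq0 => /eqP e.
    by rewrite e scaleNr scalerN opprK scalerA mulVf// scale1r.
  by rewrite scalemx_sub// submxMl.
have a0 : a = 0.
  apply: (row_free_inj ff); rewrite mul0mx -[RHS]vA b0 c0 !scale0r !addr0//.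
by move: v0; rewrite vE a0 b0 c0 !raddf0 !row_mx0 eqxx.
Qed.

End HypersurfaceGeometry.

(* In dimension 0 the empty frame may be declared negative, and then the
   normalization of eta is vacuous. *)
Section DimensionZero.
Context {R : realType} {n : nat} {N : manifold R n}.
Variable f : N -> 'rV[R]_(n + 2).
Hypothesis n_eq0 : n = 0%N.
Variables (xi eta : N -> 'rV[R]_(n + 2)) (pos : N -> 'M[R]_(n, n + 2) -> bool) (p : N).

Lemma dir_deriv_dim0 {V : normedModType R} X (Y : N -> V) :
  tangent_field f p X -> dir_deriv f X Y p = 0.
Proof.
move=> [_ /nbhs_singleton XJ].
have : (\rank (X p) <= 0)%N.
  by rewrite (leq_trans (mxrankS XJ))// (leq_trans (rank_leq_row _))// n_eq0.
rewrite leqn0 mxrank_eq0 /dir_deriv => /eqP ->.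
by rewrite mul0mx derive0.
Qed.

Lemma parallel_dim0 : parallel_at f xi p.
Proof. by move=> X tX; rewrite dir_deriv_dim0// sub0mx. Qed.

Lemma apolar_dim0 : apolar_at f xi eta p.
Proof.
move=> X E _ _; rewrite /mxtrace big1// => i; exfalso.
by move: (ltn_ord i); rewrite [X in (_ < X)%N]n_eq0.
Qed.

Lemma equiaffine_dim0 : equiaffine_at f pos xi eta p.
Proof.
move=> X Z tX _; rewrite /nabla_formn dir_deriv_dim0// big1 ?subr0// => i; exfalso.
by move: (ltn_ord i); rewrite [X in (_ < X)%N]n_eq0.
Qed.

End DimensionZero.
(* The affine metric is only defined, up to sign, once a local orientation is
   fixed.  The [W k] are open sets covering N, each with an orientation [pos k]
   and a normalized field [eta k]; when N is oriented and eta is defined on all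
   of N, a single W = N suffices. *)
Theorem proposition5p3 (R : realType) (n : nat)
  (M : manifold R n.+1) (N : manifold R n)
  (F : M -> 'rV[R]_(n + 2)) (F_immersion : immersion_vec F)
  (j : N -> M) (j_immersion : immersion j)
  (N_nondegenerate : nondegenerate_in F j)
  (xi : N -> 'rV[R]_(n + 2)) (xi_darboux : osculating_darboux F j xi)
  (K : Type) (W : K -> set N)
  (W_open : forall k, open (W k)) (W_cover : forall p, exists k, W k p)
  (pos : K -> N -> 'M[R]_(n, n + 2) -> bool)
  (pos_orientation : forall k, orientation_on (F \o j) (W k) (pos k))
  (eta : K -> N -> 'rV[R]_(n + 2))
  (eta_normal : forall k, affine_normal F j xi (W k) (pos k) (eta k)) :
  let apolar :=
    forall k p, W k p -> apolar_at (F \o j) xi (eta k) p in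
  let equiaffine :=
    forall k p, W k p -> equiaffine_at (F \o j) (pos k) xi (eta k) p in
  let parallel := forall p, parallel_at (F \o j) xi p in
  (apolar <-> equiaffine) /\ (equiaffine <-> parallel).
Proof.
move=> apolar equiaffine parallel.
have [n0|n_gt0] := posnP n.
  have ap : apolar by move=> k p _; exact: apolar_dim0.
  have eq : equiaffine by move=> k p _; exact: equiaffine_dim0.
  have par : parallel by move=> p; exact: parallel_dim0.
  by split; split.
set f := F \o j.
have f_smooth p : smooth_at p f := (comp_immersion F_immersion j_immersion p).1.
have f_free p : row_free (jac f p) := (comp_immersion F_immersion j_immersion p).2.
have xi_diff p : differentiable (xi \o par p) (chart p p).
  by have [sxi _ _ _] := xi_darboux p; exact: smooth_differentiable.
have eta_diff k p : W k p -> differentiable (eta k \o par p) (chart p p).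
  by move=> /eta_normal[seta _ _ _]; exact: smooth_differentiable.
have tr k p : W k p -> transverse f xi (eta k) p.
  move=> /eta_normal[_ etaT _ _]; have [_ xiT xiN _] := xi_darboux p.
  exact: adapted_transverse.
have tau_xi k p : W k p -> forall X, tangent_field f p X -> tau12 f xi (eta k) X p = 0.
  move=> Wp X tX; have [_ xiT xiN xiD] := xi_darboux p.
  exact: (tangent_M_eta_part F_immersion j_immersion xiT xiN (tr k p Wp) (xiD X tX)).
have tau_eta k p : W k p -> forall X, tangent_field f p X -> tau22 f xi (eta k) X p = 0.
  move=> Wp X tX; have [_ xiT xiN _] := xi_darboux p; have [_ _ _ etaD] := eta_normal k p Wp.
  exact: (tangent_M_eta_part F_immersion j_immersion xiT xiN (tr k p Wp) (etaD X tX)).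
have nondeg k p : W k p -> forall X, tangent_field f p X ->
    (forall Y, tangent_field f p Y -> h2 f xi (eta k) X Y p = 0) -> X p = 0.
  move=> Wp; have [_ xiT xiN _] := xi_darboux p; have [_ etaT _ _] := eta_normal k p Wp.
  by apply: N_nondegenerate; split.
have orient k p (Wp : W k p) := (pos_orientation k p Wp).1.
have norm k p : W k p -> forall E, positive_frame f (pos k) p E ->
    orthonormal_at f (pos k) xi p E -> bracket (frame_mx E p) (eta k p) (xi p) = 1.
  by move=> /eta_normal[].
have nearW k p (P : N -> Prop) : W k p -> (forall q, W k q -> P q) -> \forall q \near p, P q.
  by move=> Wp; exact: open_near (W_open k) Wp.
have vol k q (Wq : W k q) := volume_formE f_smooth f_free (xi_diff q) (tr k q Wq)
  (nondeg k q Wq) n_gt0 (orient k q Wq) (norm k q Wq).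
have detS k q (Wq : W k q) : `|\det (second_form f xi (eta k) q)| =
    bracket (jac f q) (eta k q) (xi q) ^+ 2.
  have [_ [P [_ _ _ //]]] := affine_metricE f_smooth f_free (xi_diff q) (tr k q Wq)
    (nondeg k q Wq) n_gt0 (orient k q Wq) (norm k q Wq).
have sffU k p (Wp : W k p) := second_form_unit f_smooth f_free (xi_diff p) (tr k p Wp) (nondeg k p Wp).
have main k p (Wp : W k p) :
    [/\ (forall X, tangent_field f p X -> tau11 f xi (eta k) p X = 0) <->
          apolar_at f xi (eta k) p,
        (forall X, tangent_field f p X -> tau11 f xi (eta k) p X = 0) <->
          equiaffine_at f (pos k) xi (eta k) p &
        (forall X, tangent_field f p X -> tau11 f xi (eta k) p X = 0) <->
          parallel_at f xi p].
  (* Openness of W k spreads the pointwise identities to a neighbourhood of p, where they can be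
     differentiated. *)
  have ntr := nearW k p _ Wp (tr k).
  have nvol := nearW k p _ Wp (vol k).
  have ndet := nearW k p _ Wp (detS k).
  split.
  - exact: (tau11_eq0_apolar f_smooth f_free xi_diff (eta_diff k p Wp) ntr
      (tau_xi k p Wp) (tau_eta k p Wp) ndet (sffU k p Wp)).
  - exact: (tau11_eq0_equiaffine f_smooth f_free xi_diff (eta_diff k p Wp) ntr
      (tau_eta k p Wp) nvol).
  - exact: (tau11_eq0_parallel ntr (tau_xi k p Wp)).
split; split.
- by move=> H k p Wp; have [ap eq _] := main k p Wp; apply/eq/ap/H.
- by move=> H k p Wp; have [ap eq _] := main k p Wp; apply/ap/eq/H.
(* Being parallel involves neither eta nor an orientation, so any W k containing p will do. *)
- move=> H p; have [k Wp] := W_cover p.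
  by have [_ eq par] := main k p Wp; apply/par/eq/H.
- by move=> H k p Wp; have [_ eq par] := main k p Wp; apply/eq/par/H.
Qed.
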